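(* If $z\in\mathcal I(W_n)$ and $w\in\mathcal A(z)^{-1}$ then $\mathrm{sh}(w)\in\mathsf{NCSP}(z)$; in other words, the shape of $w$ (which is a symmetric and perfect matching in $\{i\in[\pm n]:z(i)=-i\}$) is also noncrossing.
   Context: $[n]=\{1,\dots,n\}$, $[\pm n]=\{\pm1,\dots,\pm n\}$, $n\ge1$. $W_n$ is the group of bijections $w:[\pm n]\to[\pm n]$ with $w(-i)=-w(i)$, a Coxeter group with simple generators $t_0=(-1,1)$, $t_i=(-i,-i-1)(i,i+1)$ ($i\in[n-1]$) and length function $\ell$. The Demazure product $\circ$ is the unique associative product on $W_n$ with $s\circ s=s$ for simple $s$ and $u\circ v=uv$ whenever $\ell(uv)=\ell(u)+\ell(v)$. $\mathcal I(W_n)=\{w:w=w^{-1}\}$. For $z\in\mathcal I(W_n)$, $\mathcal A(z)$ is the set of minimal-length $w\in W_n$ with $w^{-1}\circ w=z$, and $\mathcal A(z)^{-1}=\{w^{-1}:w\in\mathcal A(z)\}$. Identify $w\in W_n$ with its one-line word $w_1\cdots w_n$, $w_i=w(i)$. Starting from the word of $w\in\mathcal A(z)^{-1}$, repeatedly choose two consecutive letters $b\,a$ with $b>a$ and delete both, until the remaining word $\xi(w)$ is increasing. For $w\in\mathcal A(z)^{-1}$ the word $\xi(w)$ and the set $\mathrm{NDes}(w)$ of deleted pairs $(b,a)$ do not depend on the choices. $\mathrm{NNeg}(w)$ is the set of absolute values of the negative letters of $\xi(w)$. The shape $\mathrm{sh}(w)$ is the matching whose blocks are $\{a,b\}$ and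 $\{-a,-b\}$ for each $(a,-b)\in\mathrm{NDes}(w)$ with $0<a<b$, together with $\{e,-e\}$ for each $e\in\mathrm{NNeg}(w)$. For $X=-X\subset[\pm n]$, a matching in $X$ is a set of pairwise disjoint 2-element subsets of $X$; it is perfect if it covers $X$, symmetric if $\{i,j\}\in M\Rightarrow\{-i,-j\}\in M$, noncrossing if no two blocks $\{i,k\},\{j,l\}$ have $i<j<k<l$. $\mathsf{NCSP}(z)$ is the set of noncrossing, symmetric, perfect matchings in $\{i\in[\pm n]:z(i)=-i\}$. *)

(* Defs.v *)
From mathcomp Require Import all_boot all_order all_algebra all_fingroup.

Set Implicit Arguments.
Unset Strict Implicit.
Unset Printing Implicit Defensive.

Import Order.TTheory GRing.Theory Num.Theory.
Local Open Scope ring_scope.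

(* The letters [±n]: (false, k) is the letter k + 1 and (true, k) is -(k + 1). *)
Notation pm n := (bool * 'I_n)%type.

Definition pmval (n : nat) (x : pm n) : int :=
  if x.1 then - (x.2.+1)%:Z else (x.2.+1)%:Z.

Definition pmopp (n : nat) (x : pm n) : pm n := (~~ x.1, x.2).

Definition pmlt (n : nat) : rel (pm n) := fun x y => pmval x < pmval y.

Definition signed_perms (n : nat) : {set {perm pm n}} :=
  [set w : {perm pm n} | [forall i, w (pmopp i) == pmopp (w i)]].

(* Products are composed right to left, (u v)(i) = u(v(i)), which is the
   opposite of MathComp's product of permutations. *)
Definition pmul (n : nat) (u v : {perm pm n}) : {perm pm n} := (v * u)%g.

Definition ord_predn (n : nat) (i : 'I_n) : 'I_n :=
  Ordinal (leq_ltn_trans (leq_pred i) (ltn_ord i)).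

(* For i > 0, the letters i and i + 1 are (false, ord_predn i) and (false, i). *)
Definition simple_gen (n : nat) (i : 'I_n) : {perm pm n} :=
  if i == 0%N :> nat then tperm (true, i) (false, i)
  else pmul (tperm (true, ord_predn i) (true, i))
            (tperm (false, ord_predn i) (false, i)).

Definition word_prod (n : nat) (s : seq 'I_n) : {perm pm n} :=
  foldr (fun i u => pmul (simple_gen i) u) 1%g s.

(* The least size of a word in the simple generators with product w. The bound
   on k is harmless on signed_perms: the prefixes of a shortest word have
   pairwise distinct products, so its size is less than #|signed_perms n|. *)
Definition cox_length (n : nat) (w : {perm pm n}) : nat :=
  \big[minn/#|signed_perms n|]_(k < #|signed_perms n|
     | [exists s : k.-tuple 'I_n, word_prod s == w]) k.

(* These properties determine dem uniquely on signed_perms; its values outside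
   signed_perms are irrelevant. *)
Definition is_demazure_product (n : nat)
    (dem : {perm pm n} -> {perm pm n} -> {perm pm n}) : Prop :=
  [/\ {in signed_perms n &, forall u v, dem u v \in signed_perms n},
      {in signed_perms n & &, associative dem},
      forall i : 'I_n, dem (simple_gen i) (simple_gen i) = simple_gen i
    & {in signed_perms n &, forall u v,
        cox_length (pmul u v) = (cox_length u + cox_length v)%N ->
        dem u v = pmul u v}].

Definition involutions (n : nat) : {set {perm pm n}} :=
  [set z in signed_perms n | z == z^-1%g].

Definition atoms (n : nat) (dem : {perm pm n} -> {perm pm n} -> {perm pm n})
    (z : {perm pm n}) : {set {perm pm n}} :=
  [set w in signed_perms n | (dem w^-1%g w == z) &&
     [forall v in signed_perms n,
        (dem v^-1%g v == z) ==> (cox_length w <= cox_length v)%N]].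

Definition inv_atoms (n : nat) (dem : {perm pm n} -> {perm pm n} -> {perm pm n})
    (z : {perm pm n}) : {set {perm pm n}} :=
  [set w^-1%g | w in atoms dem z].

Definition one_line (n : nat) (w : {perm pm n}) : seq (pm n) :=
  [seq w (false, i) | i <- enum 'I_n].

(* nested_descents s D r: some sequence of deletions of consecutive letters
   b a with b > a leads from s to the increasing word r, and D is the set of
   the deleted pairs (b, a). *)
Inductive nested_descents (n : nat) :
    seq (pm n) -> {set pm n * pm n} -> seq (pm n) -> Prop :=
| NDesDone s : sorted (@pmlt n) s -> nested_descents s set0 s
| NDesDelete s1 s2 b a D r :
    pmlt a b -> nested_descents (s1 ++ s2) D r ->
    nested_descents (s1 ++ b :: a :: s2) ((b, a) |: D) r.

Definition abs_neg (n : nat) (r : seq (pm n)) : {set pm n} :=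
  [set pmopp x | x in r & pmval x < 0].

(* A deleted pair p = (a, -b) contributes blocks exactly when 0 < a < b. *)
Definition shape_of (n : nat) (D : {set pm n * pm n}) (r : seq (pm n)) :
    {set {set pm n}} :=
  let D' := [set p in D | 0 < pmval p.1 < pmval (pmopp p.2)] in
  [set [set p.1; pmopp p.2] | p in D'] :|: [set [set pmopp p.1; p.2] | p in D']
  :|: [set [set e; pmopp e] | e in abs_neg r].

(* M is the shape of w computed along some complete sequence of deletions. *)
Definition is_shape (n : nat) (w : {perm pm n}) (M : {set {set pm n}}) : Prop :=
  exists D r, nested_descents (one_line w) D r /\ M = shape_of D r.

Definition matching_in (n : nat) (X : {set pm n}) (M : {set {set pm n}}) : bool :=
  [forall B in M, (B \subset X) && (#|B| == 2)] && trivIset M.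

Definition perfect_in (n : nat) (X : {set pm n}) (M : {set {set pm n}}) : bool :=
  cover M == X.

Definition symmetric_matching (n : nat) (M : {set {set pm n}}) : bool :=
  [forall i : pm n, forall j : pm n,
     ([set i; j] \in M) ==> ([set pmopp i; pmopp j] \in M)].

Definition noncrossing (n : nat) (M : {set {set pm n}}) : bool :=
  [forall i : pm n, forall j : pm n, forall k : pm n, forall l : pm n,
     [&& pmlt i j, pmlt j k & pmlt k l] ==>
     ~~ (([set i; k] \in M) && ([set j; l] \in M))].

Definition negated_points (n : nat) (z : {perm pm n}) : {set pm n} :=
  [set i | z i == pmopp i].

Definition NCSP (n : nat) (z : {perm pm n}) : {set {set {set pm n}}} :=
  [set M | [&& matching_in (negated_points z) M, perfect_in (negated_points z) M,
               symmetric_matching M & noncrossing M]].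

(* Main.v *)
(** An atom w of z is built from the identity by left multiplications that
    exchange the letters i and i+1, or change the sign of the letter 1, while z
    moves up the involution weak order. Positions do not move, so one can track
    a pairing of the positions of w: two positions are joined when z passes from
    fixing i and i+1 to exchanging them, and nothing else changes. This yields
    blocks of one or two letters on which z is a transposition, the identity or
    minus the identity. Explicit conditions on the relative order of positions
    and values in any two blocks are preserved by every step. They imply that
    two letters that become adjacent after deleting whole blocks form an ascent
    unless they are a block, so any sequence of deletions removes exactly the
    two-letter blocks; and they imply that the matching read off from the blocks
    negated by z is noncrossing. *)
Require Import Defs.
From mathcomp Require Import all_boot all_order all_algebra all_fingroup.
From Stdlib Require Import ZArith Lia.
(* Importing [ssrnat] again gives the delimiter [%N], which [ZArith] takes over,
   back to [nat_scope]. *)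
From mathcomp Require Import ssrnat zify.

Set Implicit Arguments.
Unset Strict Implicit.
Unset Printing Implicit Defensive.

(** * Blocks of letters and their relative positions *)

Section Blocks.
Local Open Scope Z_scope.

(** Noncrossing concerns only the letters negated by z, but it is not inductive by itself. Negated
    blocks arise from blocks of positive sum in two ways: a lone letter 1 becomes -1, or a block
    with letters i+1 and -i becomes i and -(i+1), while z passes from exchanging i+1 and -i to
    negating both. So relations are carried for pairs of positive blocks and for mixed pairs as
    well, and they mention positions, because an ascent of w is a statement about positions. The
    sign of the sum of the two letters records how z acts on a block, and these two kinds of steps
    are the only ones that change it. Two letters negated by z are never exchanged with each other:
    z reverses their order, so i would be a descent of z. A generator reverses only comparisons
    between letters that are adjacent up to a common sign, so each step comes down to a few special
    comparisons, settled by linear arithmetic. *)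

Record block := Block { fpos : Z; lpos : Z; fval : Z; lval : Z }.

(** A one-letter block repeats its position and its letter. In a two-letter block the larger letter
    comes first and is positive, so the block is a descent; the nonzero sum leaves just two types of
    blocks. *)
Definition good_block (A : block) : Prop :=
  let: Block p q y x := A in
  x + y <> 0 /\ (p = q /\ y = x \/ p < q /\ x < y /\ 0 < y).

(* The conditions [pos_pos], [pos_neg] and [neg_neg] were found by listing the
   relative positions of two blocks in all atoms of W_4: they describe exactly
   the configurations that occur. *)
Definition pos_pos (A B : block) : Prop :=
  let: Block p q y x := A in let: Block r s v u := B in
  x < u -> (y < v -> q < r) /\ (v < y -> (r < p \/ q < r) /\ (s < p \/ q < s)).

Definition pos_neg (A B : block) : Prop :=
  let: Block p q y x := A in let: Block r s v u := B in
  s < p \/ (x < u /\ (q < r \/ r < p /\ q < s)) \/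
  (y < v /\ (q < r \/ p < r /\ s < q)).

Definition neg_neg (A B : block) : Prop :=
  let: Block p q y x := A in let: Block r s v u := B in
  x < u -> (y < v /\ q < r) \/ (- u < y /\ (q < r \/ s < p \/ r < p /\ q < s)).

Definition block_sum A := lval A + fval A.

(** A positive sum means that z exchanges the letters of the block or fixes its only letter, a
    negative sum that z negates them. The relation is not symmetric, and mixed pairs are constrained
    with the positive block first; a pair of blocks is controlled by both orders together. *)
Definition compatible (A B : block) : Prop :=
  (0 < block_sum A -> 0 < block_sum B -> pos_pos A B) /\
  (0 < block_sum A -> block_sum B < 0 -> pos_neg A B) /\
  (block_sum A < 0 -> block_sum B < 0 -> neg_neg A B).

Definition disjoint_blocks (A B : block) : Prop :=
  let: Block p q y x := A in let: Block r s v u := B in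
  [/\ y <> v, y <> u, x <> v & x <> u] /\
  [/\ y <> - v, y <> - u, x <> - v & x <> - u] /\
  [/\ p <> r, p <> s, q <> r & q <> s].

(* [lia] expands all the disjunctions in its context before refuting the cases,
   which is out of reach for two blocks. [either] hides them from [lia], and
   [case_search] splits them one at a time with unit propagation. *)
Definition either (P Q : Prop) := P \/ Q.

Lemma impl_either (a b : Z) (P : Prop) : (a < b -> P) -> either (b <= a) P.
Proof. by case: (Z.lt_ge_cases a b) => h k; [right; apply: k | left]. Qed.

Lemma neq_either (a b : Z) : a <> b -> either (a < b) (b < a).
Proof. rewrite /either; lia. Qed.

Ltac hide_ors := repeat match goal with
  | H : _ /\ _ |- _ => destruct H
  | H : and4 _ _ _ _ |- _ => destruct H
  | H : ?a < ?b -> _ |- _ => apply impl_either in H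
  | H : _ <> _ |- _ => apply neq_either in H
  | H : ?A \/ ?B |- _ => change (either A B) in H
  end.

Ltac unit_propagate := repeat (hide_ors; match goal with
  | H : either _ _ |- _ =>
      let K := fresh in
      first [ destruct H as [K|K]; [exfalso; hide_ors; lia|]
            | destruct H as [K|K]; [|exfalso; hide_ors; lia] ]
  end).

Ltac case_search := hide_ors; try lia; unit_propagate; try lia;
  match goal with
  | H : either _ _ |- _ => destruct H; case_search
  end.

(** The last four hypotheses keep the positions of both blocks out of the gap between a and b. This
    is what remains of adjacency once other whole blocks have been deleted, so the lemma serves
    every stage of the deletion process. *)
Lemma adjacent_ascent p q y x r s v u a b c d :
  let A := Block p q y x in let B := Block r s v u in
  good_block A -> good_block B -> disjoint_blocks A B ->
  compatible A B -> compatible B A ->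
  (a = p /\ c = y \/ a = q /\ c = x) -> (b = r /\ d = v \/ b = s /\ d = u) ->
  a < b -> (p <= a \/ b <= p) -> (q <= a \/ b <= q) ->
  (r <= a \/ b <= r) -> (s <= a \/ b <= s) -> c < d.
Proof.
move=> /= [gA1 gA2] [gB1 gB2] [[n1 n2 n3 n4] [[n5 n6 n7 n8] [m1 m2 m3 m4]]] cAB cBA ea eb ab hp hq hr hs.
have sA : 0 < x + y \/ x + y < 0 by clear -gA1; lia.
have sB : 0 < u + v \/ u + v < 0 by clear -gB1; lia.
move: cAB cBA; rewrite /compatible /= => -[h1 [h2 h3]] [k1 [k2 k3]].
case: sA => sA; case: sB => sB.
- have {h1 h2 h3 k2 k3}h := h1 sA sB; have {k1} := k1 sB sA; move: h; rewrite /pos_pos.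
  by case: ea => -[??]; case: eb => -[??]; subst; case_search.
- have {h1 h2 h3 k1 k2 k3} := h2 sA sB; rewrite /pos_neg.
  by case: ea => -[??]; case: eb => -[??]; subst; case_search.
- have {h1 h2 h3 k1 k2 k3} := k2 sB sA; rewrite /pos_neg.
  by case: ea => -[??]; case: eb => -[??]; subst; case_search.
- have {h1 h2 h3 k2 k1}h := h3 sA sB; have {k3} := k3 sB sA; move: h; rewrite /neg_neg.
  by case: ea => -[??]; case: eb => -[??]; subst; case_search.
Qed.

Lemma neg_neg_noncrossing A B a b c d :
  good_block A -> good_block B -> disjoint_blocks A B ->
  compatible A B -> compatible B A ->
  block_sum A < 0 -> block_sum B < 0 ->
  (a = fval A /\ c = - lval A) \/ (a = - lval A /\ c = fval A) \/
  (a = - fval A /\ c = lval A) \/ (a = lval A /\ c = - fval A) ->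
  (b = fval B /\ d = - lval B) \/ (b = - lval B /\ d = fval B) \/
  (b = - fval B /\ d = lval B) \/ (b = lval B /\ d = - fval B) ->
  a < b -> b < c -> c < d -> False.
Proof.
case: A => p q y x; case: B => r s v u.
move=> /= [gA1 gA2] [gB1 gB2] [[n1 n2 n3 n4] [[n5 n6 n7 n8] [m1 m2 m3 m4]]] [_ [_ h]] [_ [_ k]] sA sB.
have {k} := k sB sA; have {h} := h sA sB; rewrite /neg_neg /block_sum /= in sA sB *.
move=> h k ea eb ab bc cd.
have {gA2}gA : y = x \/ 0 < y by case: gA2 => -[_]; tauto.
have {gB2}gB : v = u \/ 0 < v by case: gB2 => -[_]; tauto.
(* Positions are dropped here. Of the arcs from y to -x and from v to -u, the one with the larger
   right end contains the other or lies to its right. *)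
have nest : x < u /\ (y < v \/ - u < y) \/ u < x /\ (v < y \/ - x < v).
  case: (Z.lt_total x u) => [xu|[//|ux]].
  - by left; split=> //; case: (h xu) => -[? _]; [left|right].
  - by right; split=> //; case: (k ux) => -[? _]; [left|right].
move: ea eb => [[? ?]|[[? ?]|[[? ?]|[? ?]]]] [[? ?]|[[? ?]|[[? ?]|[? ?]]]]; subst;
  clear -sA sB gA gB nest ab bc cd; case_search.
Qed.

(** * Adjacent letters exchanged by a simple generator *)

Definition swapv (k v : Z) : Z :=
  if v =? k then k + 1 else if v =? k + 1 then k
  else if v =? - k then - (k + 1) else if v =? - (k + 1) then - k else v.

Definition swap_block k (A : block) :=
  let: Block p q y x := A in Block p q (swapv k y) (swapv k x).

(** For a block with letters y and x this is the image of y under z. *)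
Definition letter_image (y x : Z) := if 0 <? y + x then x else - y.

(* y and v are letters at positions p and q with images zy and zv under z. The
   four clauses say that w^-1 and z increase from k to k + 1, where k and k + 1
   are y and v up to sign. *)
Definition ascending_letters (k p y zy q v zv : Z) : Prop :=
  (y = k -> v = k + 1 -> p < q /\ zy < zv) /\
  (y = k -> v = - (k + 1) -> False) /\
  (y = - k -> v = k + 1 -> - zy < zv) /\
  (y = - k -> v = - (k + 1) -> q < p /\ zv < zy).

Definition ascending_blocks k A B :=
  let: Block p q y x := A in let: Block r s v u := B in
  let zy := letter_image y x in let zx := letter_image x y in
  let zv := letter_image v u in let zu := letter_image u v in
  (ascending_letters k p y zy r v zv /\ ascending_letters k q x zx r v zv) /\
  (ascending_letters k p y zy s u zu /\ ascending_letters k q x zx s u zu).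

Definition adjacent_letters (k a b : Z) :=
  [\/ a = k /\ b = k + 1, a = k + 1 /\ b = k, a = - k /\ b = - (k + 1)
    | a = - (k + 1) /\ b = - k].

Lemma swapvP k v : 0 < k ->
  (v = k /\ swapv k v = k + 1) \/ (v = k + 1 /\ swapv k v = k) \/
  (v = - k /\ swapv k v = - (k + 1)) \/ (v = - (k + 1) /\ swapv k v = - k) \/
  ((v <> k /\ v <> k + 1 /\ v <> - k /\ v <> - (k + 1)) /\ swapv k v = v).
Proof.
rewrite /swapv => k0.
case: (Z.eqb_spec v k) => h1; first by left.
case: (Z.eqb_spec v (k + 1)) => h2; first by right; left.
case: (Z.eqb_spec v (- k)) => h3; first by right; right; left.
case: (Z.eqb_spec v (- (k + 1))) => h4; first by do 3 right; left.
by do 4 right.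
Qed.

Lemma swapv_opp k v : 0 < k -> swapv k (- v) = - swapv k v.
Proof. by move=> k0; have := swapvP v k0; have := swapvP (- v) k0; lia. Qed.

Lemma swapv_lt k a b : 0 < k -> adjacent_letters k a b \/
  (swapv k a < swapv k b <-> a < b) /\ (swapv k b < swapv k a <-> b < a).
Proof.
move=> k0; have ha := swapvP a k0; have hb := swapvP b k0.
case: ha => [[? ->]|[[? ->]|[[? ->]|[[? ->]|[? ->]]]]];
case: hb => [[? ->]|[[? ->]|[[? ->]|[[? ->]|[? ->]]]]];
  first [ by left; constructor 1 | by left; constructor 2 | by left; constructor 3
        | by left; constructor 4 | by right; split; lia ].
Qed.

Lemma swapv_id k a : 0 < k -> a <> k -> a <> k + 1 -> a <> - k -> a <> - (k + 1) ->
  swapv k a = a.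
Proof.
by move=> k0 *; case: (swapvP a k0) => [[? ->]|[[? ->]|[[? ->]|[[? ->]|[? ->]]]]].
Qed.

Lemma swapv_k k : swapv k k = k + 1.
Proof. by rewrite /swapv Z.eqb_refl. Qed.

Lemma swapv_k1 k : swapv k (k + 1) = k.
Proof. by rewrite /swapv Z.eqb_refl; case: Z.eqb_spec => //; lia. Qed.

(** Negating both letters reverses their order and that of their images, so the first and the last
    clause of [ascending_letters] agree: the smaller letter comes first and has the smaller
    image. *)
Lemma ascending_adjacent k p y zy q v zv : 0 < k ->
  ascending_letters k p y zy q v zv -> ascending_letters k q v zv p y zy ->
  adjacent_letters k y v ->
  [/\ swapv k y = v, swapv k v = y &
      (v = y + 1 /\ p < q /\ zy < zv) \/ (y = v + 1 /\ q < p /\ zv < zy)].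
Proof.
move=> k0 [h1 [_ [_ h2]]] [k1 [_ [_ k2]]] [] [ey ev].
- have h := h1 ey ev; clear -h k0 ey ev; subst; rewrite swapv_k swapv_k1; split=> //; lia.
- have h := k1 ev ey; clear -h k0 ey ev; subst; rewrite swapv_k swapv_k1; split=> //; lia.
- have h := h2 ey ev; clear -h k0 ey ev; subst; rewrite !(swapv_opp _ k0) swapv_k swapv_k1; split=> //; lia.
- have h := k2 ev ey; clear -h k0 ey ev; subst; rewrite !(swapv_opp _ k0) swapv_k swapv_k1; split=> //; lia.
Qed.

(** The second clause of [ascending_letters] forbids k together with -(k + 1), so the letters are k
    + 1 and -k. Their sum is 1 before the exchange and -1 after it. *)
Lemma ascending_adjacent_opp k p y zy q v zv : 0 < k ->
  ascending_letters k p y zy q v zv -> ascending_letters k q v zv p y zy ->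
  adjacent_letters k (- v) y ->
  [/\ swapv k y = - v, swapv k v = - y, y = 1 - v & 0 < zy + zv].
Proof.
move=> k0 [_ [h1 [h2 _]]] [_ [k1 [k2 _]]] [] [ev ey].
- have h := k2 ltac:(clear -ev; lia) ey; clear -h k0 ey ev.
  have -> : v = - k by lia.
  clear ev; by subst; rewrite !(swapv_opp _ k0) swapv_k swapv_k1; split=> //; lia.
- by case: h1; lia.
- by case: k1; lia.
- have h := h2 ey ltac:(clear -ev; lia); clear -h k0 ey ev.
  have -> : v = k + 1 by lia.
  clear ev; by subst; rewrite !(swapv_opp _ k0) swapv_k swapv_k1; split=> //; lia.
Qed.

Lemma letter_image_pos y x : 0 < y + x -> letter_image y x = x.
Proof. by rewrite /letter_image; case: Z.ltb_spec => //; lia. Qed.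

Lemma letter_image_neg y x : y + x < 0 -> letter_image y x = - y.
Proof. by rewrite /letter_image; case: Z.ltb_spec => //; lia. Qed.

Ltac swap_cases k y k0 := let e := fresh in
  case: (@swapvP k y k0) => [[? e]|[[? e]|[[? e]|[[? e]|[[? [? [? ?]]] e]]]]]; rewrite ?e {e}.

Lemma swap_good k A : 0 < k -> good_block A -> ascending_blocks k A A ->
  good_block (swap_block k A).
Proof.
case: A => p q y x k0 [g1 g2] asc.
have h1 : p < q -> ~ (x = k /\ y = k + 1).
  move=> pq [ex ey]; move: asc => [[_ [asc _]] _].
  by have [] := asc ex ey; lia.
have h2 : ~ (y = k /\ x = - (k + 1)).
  move=> [ey ex]; move: asc => [_ [[_ [asc _]] _]].
  exact: asc ey ex.
clear asc; rewrite /good_block /=.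
case: g2 => [[pq yx]|[pq [xy y0]]].
  by subst; clear h1 h2; swap_cases k x k0; lia.
have {}h1 := h1 pq.
swap_cases k x k0; swap_cases k y k0; lia.
Qed.

Lemma compatible_transfer p q r s y x v u y' x' v' u' :
  (0 < x + y <-> 0 < x' + y') -> (x + y < 0 <-> x' + y' < 0) ->
  (0 < u + v <-> 0 < u' + v') -> (u + v < 0 <-> u' + v' < 0) ->
  (x < u <-> x' < u') -> (y < v <-> y' < v') -> (v < y <-> v' < y') ->
  (- u < y <-> - u' < y') ->
  compatible (Block p q y x) (Block r s v u) ->
  compatible (Block p q y' x') (Block r s v' u').
Proof.
rewrite /compatible /block_sum /pos_pos /pos_neg /neg_neg /=.
by move=> -> -> -> -> -> -> -> ->.
Qed.

Lemma swap_compatible k A B : 0 < k -> good_block A -> good_block B ->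
  disjoint_blocks A B -> compatible A B -> compatible B A ->
  ascending_blocks k A A -> ascending_blocks k A B ->
  ascending_blocks k B A -> ascending_blocks k B B ->
  (fpos A = lpos A -> fpos B = lpos B -> fval A = k -> fval B = k + 1 -> False) ->
  (fpos A = lpos A -> fpos B = lpos B -> fval B = k -> fval A = k + 1 -> False) ->
  compatible (swap_block k A) (swap_block k B).
Proof.
case: A => p q y x; case: B => r s v u k0 gA gB dAB cAB cBA aAA aAB aBA aBB nm1 nm2.
(* Exchanging k and k + 1 reverses only comparisons between adjacent letters, so
   each of the comparisons in [compatible] is either kept or special. *)
have gA' := swap_good k0 gA aAA; have gB' := swap_good k0 gB aBB.
have syx := swapv_lt (- y) x k0; have svu := swapv_lt (- v) u k0.
have sxu := swapv_lt x u k0; have syv := swapv_lt y v k0; have suy := swapv_lt (- u) y k0.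
move: syx svu sxu syv suy; rewrite !swapv_opp //.
move=> [adj|yx] + + + +.
  (* The letters of A are k + 1 and -k and become k and -(k + 1): A turns negative, and [neg_neg]
     for the new pair has to come from [pos_neg] for the old one. *)
  move=> _ _ _ _.
  move: (aAA) => [[_ a1] [a2 _]].
  have [Tx Ty xy _] := ascending_adjacent_opp k0 a1 a2 adj.
  have [Tv Tu] : swapv k v = v /\ swapv k u = u.
    move: dAB => [[n1 n2 n3 n4] [[n5 n6 n7 n8] _]].
    by clear -k0 adj n1 n2 n3 n4 n5 n6 n7 n8; split; apply: swapv_id => //; case: adj; lia.
  rewrite /= Tx Ty Tv Tu; move: gA gB dAB cAB cBA; clear -xy.
  rewrite /compatible /block_sum /pos_pos /pos_neg /neg_neg /= => -[gA1 gA2] [gB1 gB2] dAB.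
  have sA : 0 < x + y by lia.
  move=> -[h1 [h2 h3]] [k1 [k2 k3]]; split; [|split] => ? ?.
  - lia.
  - lia.
  - have {h2} := h2 sA ltac:(lia); have {h1 h3 k1 k2 k3} nB : u + v < 0 by lia.
    by move=> h; hide_ors; case_search.
move=> [adj|vu] + + +.
  (* Now B turns negative: [pos_neg] for the new pair comes from [pos_pos] in both orders, and
     [neg_neg] from [pos_neg] of B and A. *)
  move=> _ _ _.
  move: (aBB) => [[_ a1] [a2 _]].
  have [Tu Tv uv _] := ascending_adjacent_opp k0 a1 a2 adj.
  have [Ty Tx] : swapv k y = y /\ swapv k x = x.
    move: dAB => [[n1 n2 n3 n4] [[n5 n6 n7 n8] _]].
    by clear -k0 adj n1 n2 n3 n4 n5 n6 n7 n8; split; apply: swapv_id => //; case: adj; lia.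
  rewrite /= Tx Ty Tv Tu; move: gA gB dAB cAB cBA; clear -uv.
  rewrite /compatible /block_sum /pos_pos /pos_neg /neg_neg /= => -[gA1 gA2] [gB1 gB2] dAB.
  have sB : 0 < u + v by lia.
  move=> -[h1 [h2 h3]] [k1 [k2 k3]]; split; [|split] => sA sB'.
  - lia.
  - have {}h1 := h1 sA sB; have {h2 h3 k2 k3}k1 := k1 sB sA.
    by hide_ors; case_search.
  - have {h1 h2 h3 k1 k3}k2 := k2 sB sA.
    by hide_ors; case_search.
move=> [adj|exu] + +.
  move=> _ _.
  move: (aAB) (aBA) => [_ [_ a1]] [_ [_ a2]].
  (* One-letter blocks of positive sum holding k and k + 1 are the merging case, excluded by [nm1]
     and [nm2]. *)
  have nm : p = q -> r = s -> y = x -> v = u -> 0 < x + y -> False.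
    move=> pq rs yx' vu' x0; move: nm1 nm2 => /= => /(_ pq rs) nm1 /(_ pq rs) nm2.
    by case: adj => -[ex eu]; lia.
  have [Tx Tu hxu] := ascending_adjacent k0 a1 a2 adj.
  have [Ty Tv] : (y = x /\ swapv k y = u \/ swapv k y = y) /\ (v = u /\ swapv k v = x \/ swapv k v = v).
    move: dAB gA gB => [[n1 n2 n3 n4] [[n5 n6 n7 n8] _]] [gA gA2] [gB gB2]; split.
    + case: gA2 => [[_ ->]|[_ [xy _]]]; [by left|right].
      by clear -k0 adj n1 n2 n3 n4 n5 n6 n7 n8 gA xy; apply: swapv_id => //; case: adj; lia.
    + case: gB2 => [[_ ->]|[_ [uv _]]]; [by left|right].
      by clear -k0 adj n1 n2 n3 n4 n5 n6 n7 n8 gB uv; apply: swapv_id => //; case: adj; lia.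
  rewrite /= Tx Tu; move: Ty Tv hxu nm yx vu gA gB gA' gB' dAB cAB cBA; rewrite /= Tx Tu; clear.
  move: (swapv k y) (swapv k v) => y' v' Ty Tv hxu nm yx vu [gA1 gA2] [gB1 gB2] [gA1' gA2'] [gB1' gB2'] dAB.
  have sA : 0 < x + y \/ x + y < 0 by clear -gA1; lia.
  have sB : 0 < u + v \/ u + v < 0 by clear -gB1; lia.
  rewrite /compatible /block_sum /pos_pos /pos_neg /neg_neg /= => -[h1 [h2 h3]] [k1 [k2 k3]].
  have [sA1 sA2] : (0 < u + y' <-> 0 < x + y) /\ (u + y' < 0 <-> x + y < 0) by clear -yx gA1 gA1'; lia.
  have [sB1 sB2] : (0 < x + v' <-> 0 < u + v) /\ (x + v' < 0 <-> u + v < 0) by clear -vu gB1 gB1'; lia.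
  move: nm; rewrite sA1 sA2 sB1 sB2 => nm; clear sA1 sA2 sB1 sB2 yx vu.
  split; [|split] => {}sA {}sB.
  - have {}h1 := h1 sA sB; have {h2 h3 k2 k3}k1 := k1 sB sA.
    move: hxu; rewrite !letter_image_pos; [|clear -sA sB; lia..] => hxu.
    have {}nm : either (p < q) (r < s).
      case: gA2 => [[pq xy]|[pq _]]; last by left.
      case: gB2 => [[rs uv]|[rs _]]; last by right.
      by case: (nm pq rs xy uv sA).
    by case_search.
  - have {h1 h3 k1 k2 k3 nm}h2 := h2 sA sB.
    move: hxu; rewrite letter_image_pos ?letter_image_neg; [|clear -sA sB; lia..] => hxu.
    by case_search.
  (* If z negates both letters, it reverses their order, so [hxu] is contradictory. *)
  - have {}h3 := h3 sA sB; have {h2 h1 k2 k1 nm}k3 := k3 sB sA.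
    move: hxu; rewrite !letter_image_neg; [|clear -sA sB; lia..] => hxu.
    by case_search.
move=> [adj|eyv] +.
  move=> _.
  move: (aAB) (aBA) => [[a1 _] _] [[a2 _] _].
  have [Ty Tv hyv] := ascending_adjacent k0 a1 a2 adj.
  have [Tx Tu] : (y = x /\ swapv k x = v \/ swapv k x = x) /\ (v = u /\ swapv k u = y \/ swapv k u = u).
    move: dAB gA gB => [[n1 n2 n3 n4] [[n5 n6 n7 n8] _]] [gA gA2] [gB gB2]; split.
    + case: gA2 => [[_ <-]|[_ [xy _]]]; [by left|right].
      by clear -k0 adj n1 n2 n3 n4 n5 n6 n7 n8 gA xy; apply: swapv_id => //; case: adj; lia.
    + case: gB2 => [[_ <-]|[_ [uv _]]]; [by left|right].
      by clear -k0 adj n1 n2 n3 n4 n5 n6 n7 n8 gB uv; apply: swapv_id => //; case: adj; lia.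
  rewrite /= Ty Tv; move: Tx Tu hyv exu yx vu gA gB gA' gB' dAB cAB cBA; rewrite /= Ty Tv; clear.
  move: (swapv k x) (swapv k u) => x' u' Tx Tu hyv exu yx vu [gA1 gA2] [gB1 gB2] [gA1' gA2'] [gB1' gB2'] dAB.
  have sA : 0 < x + y \/ x + y < 0 by clear -gA1; lia.
  have sB : 0 < u + v \/ u + v < 0 by clear -gB1; lia.
  rewrite /compatible /block_sum /pos_pos /pos_neg /neg_neg /= => -[h1 [h2 h3]] [k1 [k2 k3]].
  have [sA1 sA2] : (0 < x' + v <-> 0 < x + y) /\ (x' + v < 0 <-> x + y < 0) by clear -yx gA1 gA1'; lia.
  have [sB1 sB2] : (0 < u' + y <-> 0 < u + v) /\ (u' + y < 0 <-> u + v < 0) by clear -vu gB1 gB1'; lia.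
  (* Two one-letter blocks cannot occur here: their last letters would be exchanged too, whereas
     [exu] says that this comparison is kept. *)
  have nm : either (p < q) (r < s).
    case: gA2 => [[pq xy]|[pq _]]; last by left.
    case: gB2 => [[rs uv]|[rs _]]; last by right.
    case: gA2' => [[_ xy']|]; last by clear -pq; lia.
    case: gB2' => [[_ uv']|]; last by clear -rs; lia.
    by clear -xy uv xy' uv' exu hyv; lia.
  rewrite sA1 sA2 sB1 sB2; clear sA1 sA2 sB1 sB2 yx vu exu.
  split; [|split] => {}sA {}sB.
  - have {}h1 := h1 sA sB; have {h2 h3 k2 k3}k1 := k1 sB sA.
    move: hyv; rewrite !letter_image_pos; [|clear -sA sB; lia..] => hyv.
    by case_search.
  - have {h1 h3 k1 k2 k3}h2 := h2 sA sB.
    move: hyv; rewrite letter_image_pos ?letter_image_neg; [|clear -sA sB; lia..] => hyv.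
    by case_search.
  - have {}h3 := h3 sA sB; have {h2 h1 k2 k1}k3 := k3 sB sA.
    move: hyv; rewrite !letter_image_neg; [|clear -sA sB; lia..] => hyv.
    by case_search.
move=> [adj|euy]; last by move: cAB; apply: compatible_transfer; clear -yx vu exu eyv euy; lia.
(* Only [neg_neg] compares -u with y, and two negated blocks are impossible: [euy] gives y + u = 1,
   while [z0] would read 0 < - y - u. *)
move: (aAB) (aBA) => [_ [a1 _]] [[_ a2] _].
have [Ty Tu euy z0] := ascending_adjacent_opp k0 a1 a2 adj.
have [Tx Tv] : (y = x /\ swapv k x = - u \/ swapv k x = x) /\ (v = u /\ swapv k v = - y \/ swapv k v = v).
  move: dAB gA gB => [[n1 n2 n3 n4] [[n5 n6 n7 n8] _]] [gA gA2] [gB gB2]; split.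
  + case: gA2 => [[_ <-]|[_ [xy _]]]; [by left|right].
    by clear -k0 adj n1 n2 n3 n4 n5 n6 n7 n8 gA xy; apply: swapv_id => //; case: adj; lia.
  + case: gB2 => [[_ ->]|[_ [uv _]]]; [by left|right].
    by clear -k0 adj n1 n2 n3 n4 n5 n6 n7 n8 gB uv; apply: swapv_id => //; case: adj; lia.
rewrite /= Ty Tu; move: Tx Tv z0 euy exu eyv yx vu gA gB gA' gB' dAB cAB cBA; rewrite /= Ty Tu; clear.
move: (swapv k x) (swapv k v) => x' v' Tx Tv z0 euy exu eyv yx vu [gA1 gA2] [gB1 gB2] [gA1' gA2'] [gB1' gB2'] dAB.
have sA : 0 < x + y \/ x + y < 0 by clear -gA1; lia.
have sB : 0 < u + v \/ u + v < 0 by clear -gB1; lia.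
rewrite /compatible /block_sum /pos_pos /pos_neg /neg_neg /= => -[h1 [h2 h3]] [k1 [k2 k3]].
have [sA1 sA2] : (0 < x' + - u <-> 0 < x + y) /\ (x' + - u < 0 <-> x + y < 0) by clear -yx gA1 gA1'; lia.
have [sB1 sB2] : (0 < - y + v' <-> 0 < u + v) /\ (- y + v' < 0 <-> u + v < 0) by clear -vu gB1 gB1'; lia.
rewrite sA1 sA2 sB1 sB2; clear sA1 sA2 sB1 sB2 yx vu.
have {exu}[exu exu'] : (x < u <-> x' < - y) /\ (u < x <-> - y < x') by clear -exu; lia.
have {eyv}[eyv eyv'] : (y < v <-> - u < v') /\ (v < y <-> v' < - u) by clear -eyv; lia.
rewrite -?exu -?exu' -?eyv -?eyv'; clear exu exu' eyv eyv'.
split; [|split] => {}sA {}sB.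
- exact: h1 sA sB.
- exact: h2 sA sB.
- have {}h3 := h3 sA sB; have {h2 h1 k2 k1}k3 := k3 sB sA.
  move: z0; rewrite !letter_image_neg; [|clear -sA sB; lia..] => z0.
  by case_search.
Qed.

(** * Merging two one-letter blocks, and changing the sign of the letter 1 *)

#[local] Arguments Z.add : simpl never.

(** No letter of C is k or k + 1, so each letter of C compares in the same way with both. The
    relations of C to the two one-letter blocks thus combine into those to the merged block, whose
    sum 2k + 1 is positive. *)
Lemma merge_compatible p q k C : 0 < k -> p < q -> good_block C ->
  let A := Block p p k k in let B := Block q q (k + 1) (k + 1) in
  let AB := Block p q (k + 1) k in
  disjoint_blocks A C -> disjoint_blocks B C ->
  compatible A C -> compatible B C -> compatible C A -> compatible C B ->
  compatible AB C /\ compatible C AB.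
Proof.
case: C => r s v u k0 pq [g1 g2] /= dA dB.
have sC : 0 < u + v \/ u + v < 0 by clear -g1; lia.
rewrite /compatible /block_sum /pos_pos /pos_neg /neg_neg /=.
move=> [h1 [h2 _]] [i1 [i2 _]] [j1 [j2 _]] [k1 [k2 _]].
have [kk kk1] : 0 < k + k /\ 0 < k + 1 + (k + 1) by clear -k0; lia.
case: sC => sC; split; split; [|split| |split| |split| |split] => s1 s2; try (exfalso; clear -k0 sC s1 s2; lia).
- have {}h1 := h1 kk sC; have {}i1 := i1 kk1 sC; have {}j1 := j1 sC kk; have {}k1 := k1 sC kk1.
  by clear h2 i2 j2 k2; case_search.
- have {}h1 := h1 kk sC; have {}i1 := i1 kk1 sC; have {}j1 := j1 sC kk; have {}k1 := k1 sC kk1.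
  by clear h2 i2 j2 k2; case_search.
- have {}h2 := h2 kk sC; have {}i2 := i2 kk1 sC.
  by clear h1 i1 j1 k1 j2 k2; case_search.
Qed.

(** No letter of C is -1, 0 or 1, so its comparisons with 1 and with -1 agree. A lone 1 becomes a
    negated block; in a two-letter block the first letter is at least 2, and the sum stays
    positive. *)
Lemma flip_compatible p q y C : good_block (Block p q y 1) -> good_block C ->
  let A := Block p q y 1 in
  let A' := Block p q (if p =? q then -1 else y) (-1) in
  disjoint_blocks A C -> fval C <> 0 -> lval C <> 0 ->
  compatible A C -> compatible C A ->
  [/\ good_block A', compatible A' C & compatible C A'].
Proof.
case: C => r s v u gA [gB1 gB2] /= dA v0 u0.
have sC : 0 < u + v \/ u + v < 0 by clear -gB1; lia.
have [v1 u1] : (v < -1 \/ 1 < v) /\ (u < -1 \/ 1 < u).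
  by move: dA => [[_ _ n3 n4] [[_ _ n7 n8] _]]; clear -n3 n4 n7 n8 v0 u0; lia.
rewrite /compatible /block_sum /pos_pos /pos_neg /neg_neg /=.
move=> [h1 [h2 _]] [k1 [k2 k3]].
move: gA => [gA1 [[pq y1]|[pq [y1 y0]]]].
  subst y q; rewrite Z.eqb_refl.
  split; first by split; [lia | left].
    split; [|split] => s1 s2; try (exfalso; clear -s1; lia).
    have {h1 k1 k2 k3}h2 := h2 ltac:(clear; lia) s2.
    by case_search.
  split; [|split] => s1 s2; try (exfalso; clear -s2; lia).
    have {h2 k2 k3}h1 := h1 ltac:(clear; lia) s1.
    have {}k1 := k1 s1 ltac:(clear; lia).
    by case_search.
  have {h1 k1 k2 k3}h2 := h2 ltac:(clear; lia) s1.
  by case_search.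
case: Z.eqb_spec => [|_]; first by clear -pq; lia.
have y2 : 0 < -1 + y.
  by clear -y0 y1; lia.
split; first by split; [clear -y2 | right; clear -y2 pq]; lia.
  split; [|split] => s1 s2.
  - have {h2 k2 k3}h1 := h1 ltac:(clear -y2; lia) s2.
    have {}k1 := k1 s2 ltac:(clear -y2; lia).
    by case_search.
  - have {h1 k1 k2 k3}h2 := h2 ltac:(clear -y2; lia) s2.
    by case_search.
  - by exfalso; clear -s1 y2; lia.
split; [|split] => s1 s2.
- have {h2 k2 k3}h1 := h1 ltac:(clear -y2; lia) s1.
  have {}k1 := k1 s1 ltac:(clear -y2; lia).
  by case_search.
- by exfalso; clear -s2 y2; lia.
- by exfalso; clear -s2 y2; lia.
Qed.

End Blocks.

(** * Nested descents of a word with a block structure *)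

Section Words.
Variable n : nat.
Implicit Types (w z : {perm pm n}) (x y : pm n) (p q : 'I_n) (pi : 'I_n -> 'I_n).

Definition zval x : Z := if x.1 then (- Z.of_nat x.2.+1)%Z else Z.of_nat x.2.+1.

Lemma pmltP x y : reflect (zval x < zval y)%Z (pmlt x y).
Proof.
by rewrite /pmlt /pmval /zval; case: x => [[] i]; case: y => [[] j] /=;
   apply: (iffP idP); lia.
Qed.

Lemma zval_opp x : zval (pmopp x) = (- zval x)%Z.
Proof. by case: x => [[] i]; rewrite /zval /=; lia. Qed.

Lemma zval_inj : injective zval.
Proof.
move=> [a i] [b j]; rewrite /zval /= => h.
have -> : i = j by apply: val_inj => /=; move: h; case: a; case: b => /=; lia.
by congr pair; move: h; case: a; case: b => //=; lia.
Qed.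

Lemma zval_neq0 x : zval x <> 0%Z.
Proof. by case: x => [[] i]; rewrite /zval /=; lia. Qed.

Lemma pmoppK : involutive (@pmopp n).
Proof. by case=> a i; rewrite /pmopp /= negbK. Qed.

Lemma signedP w x : w \in signed_perms n -> w (pmopp x) = pmopp (w x).
Proof. by rewrite inE => /forallP/(_ x)/eqP. Qed.

Definition letter w p : Z := zval (w (false, p)).

Definition block_at w pi p :=
  Block (Z.of_nat p) (Z.of_nat (pi p)) (letter w p) (letter w (pi p)).

(** The fixed points of pi are the one-letter blocks. A block is represented by its first position,
    the p with p <= pi p, whereas the clauses on z are needed for each of its letters and run over
    all positions. *)
Definition block_structure w z pi : Prop :=
  [/\ involutive pi,
      forall p, (0 < letter w p + letter w (pi p))%Z -> z (w (false, p)) = w (false, pi p),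
      forall p, (letter w p + letter w (pi p) < 0)%Z -> z (w (false, p)) = pmopp (w (false, p)),
      forall p, p <= pi p -> good_block (block_at w pi p)
    & forall p q, p <= pi p -> q <= pi q -> p <> q ->
        compatible (block_at w pi p) (block_at w pi q)].

Lemma letter_inj w : injective (letter w).
Proof. by move=> p q /zval_inj/perm_inj []. Qed.

Lemma letter_opp w p q : w \in signed_perms n -> letter w p <> (- letter w q)%Z.
Proof. by move=> sw; rewrite -zval_opp -signedP // => /zval_inj/perm_inj. Qed.

Lemma disjoint_block_at w pi p q : w \in signed_perms n -> involutive pi ->
  p <= pi p -> q <= pi q -> p <> q -> disjoint_blocks (block_at w pi p) (block_at w pi q).
Proof.
move=> sw piK pp qq pq.
have n1 : p <> pi q by move=> e; apply: pq; rewrite e piK in pp *; apply: val_inj => /=; lia.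
have n2 : pi p <> q by move=> e; apply: pq; rewrite -e piK in qq *; apply: val_inj => /=; lia.
have n3 : pi p <> pi q by move/(can_inj piK).
split; first by split=> /letter_inj.
split; first by split; apply: letter_opp.
by split=> /Nat2Z.inj/val_inj.
Qed.

Lemma block_ends w z pi p : block_structure w z pi ->
  exists p', [/\ p' <= pi p', p' = p \/ p' = pi p & pi p' = p \/ pi p' = pi p].
Proof.
case=> piK _ _ _ _; case: (leqP p (pi p)) => h; first by exists p; split; auto.
by exists (pi p); rewrite piK; split; auto; exact: ltnW.
Qed.

Lemma map_eq_cat (T U : Type) (f : T -> U) s s1 s2 : map f s = s1 ++ s2 ->
  exists t1 t2, [/\ s = t1 ++ t2, s1 = map f t1 & s2 = map f t2].
Proof.
move=> e; exists (take (size s1) s), (drop (size s1) s).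
by rewrite cat_take_drop map_take map_drop e take_size_cat // drop_size_cat.
Qed.

(** P lists the surviving positions. The induction works because P stays closed under pi: a deleted
    descent is a whole block by [adjacent_ascent]. At the end no two-letter block is left, since it
    would be a descent of an increasing word. *)
Lemma nested_descents_pairs w z pi s D r : w \in signed_perms n ->
  block_structure w z pi -> nested_descents s D r ->
  forall P : seq 'I_n, s = [seq w (false, p) | p <- P] ->
  pairwise (fun i j : 'I_n => i < j) P -> (forall p, p \in P -> pi p \in P) ->
  (forall d, d \in D <-> exists p, [/\ p \in P, p < pi p & d = (w (false, p), w (false, pi p))]) /\
  (forall x, x \in r <-> exists p, [/\ p \in P, pi p = p & x = w (false, p)]).
Proof.
move=> sw bs; elim=> {s D r}.
  move=> s ss P es sP clP.
  have asc p : p \in P -> p < pi p -> False.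
    move=> pP lt_p.
    have gp : good_block (block_at w pi p) by case: bs => _ _ _ + _; apply; exact: ltnW.
    have {ss} : pairwise (fun i j => pmlt (w (false, i)) (w (false, j))) P.
      move: ss; rewrite es sorted_map => ss; rewrite -sorted_pairwise //.
      by move=> i j k /pmltP h1 /pmltP h2; apply/pmltP; apply: Z.lt_trans h1 h2.
    have := clP p pP; move: pP sP; elim: P {es clP} => // i P IH.
    rewrite !inE /= => hp /andP[/allP a1 a2] hq /andP[/allP b1 b2].
    have lt_asc : ~ pmlt (w (false, p)) (w (false, pi p)).
      by move=> /pmltP; move: gp; rewrite /good_block /= /letter; lia.
    case/orP: hp => [/eqP ?|hp]; case/orP: hq => [/eqP hq|hq].
    - by subst; rewrite hq ltnn in lt_p.
    - by subst; apply: lt_asc; apply: b1.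
    - by have := a1 p hp; rewrite -hq; lia.
    - exact: IH.
  split=> d.
    by rewrite inE; split=> // -[p [pP lp _]]; case: (asc p pP lp).
  rewrite es; split.
    move=> /mapP[p pP ->]; exists p; split=> //.
    case: (ltngtP p (pi p)) => [h|h|/val_inj//]; first by case: (asc p pP h).
    by case: (asc (pi p) (clP p pP)); case: bs => ->.
  by case=> p [pP _ ->]; apply/mapP; exists p.
move=> s1 s2 b a D r /pmltP ab _ IH P /esym/map_eq_cat [P1 [P' [-> e1 e2]]].
case: P' e2 => [|u [|v P2]] //= [eb ea e2] sP clP.
move: sP; rewrite pairwise_cat /= => /and3P[/allrelP h1 sP1 /and3P[/andP[uv /allP h2] /allP h3 sP2]].
have around p : p \in P1 ++ [:: u, v & P2] -> p <= u \/ v <= p.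
  rewrite mem_cat !inE => /or4P[hp|/eqP->|/eqP->|hp].
  - by left; apply: ltnW; apply: h1 => //; rewrite mem_head.
  - by left.
  - by right.
  - by right; apply: ltnW; apply: h3.
have uP : u \in P1 ++ [:: u, v & P2] by rewrite mem_cat mem_head orbT.
have vP : v \in P1 ++ [:: u, v & P2] by rewrite mem_cat !inE eqxx !orbT.
have piK : involutive pi by case: bs.
have eqv : pi u = v.
  case: (eqVneq (pi u) v) => // nuv; exfalso.
  (* The relations are stated for first positions, so both blocks are renamed by theirs; u and v may
     be either end. *)
  have [p [pp p1 p2]] := block_ends u bs; have [q [qq q1 q2]] := block_ends v bs.
  have pq : p <> q.
    move=> pq; have : u = v \/ u = pi v \/ pi u = v \/ pi u = pi v.
      by case: p1 => e; case: q1 => e'; rewrite -e -e'; auto.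
    case=> [e|[e|[e|/(can_inj piK) e]]]; move: nuv uv; rewrite e ?piK ?eqxx ?ltnn //.
  have pP : p \in P1 ++ [:: u, v & P2] by case: p1 => ->; rewrite ?clP.
  have qP : q \in P1 ++ [:: u, v & P2] by case: q1 => ->; rewrite ?clP.
  case: (bs) => _ _ _ gb cb.
  have qp : q <> p by move=> e; apply: pq.
  have := adjacent_ascent (gb p pp) (gb q qq) (disjoint_block_at sw piK pp qq pq)
    (cb p q pp qq pq) (cb q p qq pp qp).
  have eu : u = p \/ u = pi p by case: p1 => ->; rewrite ?piK; auto.
  have ev : v = q \/ v = pi q by case: q1 => ->; rewrite ?piK; auto.
  move=> /(_ (Z.of_nat u) (Z.of_nat v) (letter w u) (letter w v)) H.
  suff : (letter w u < letter w v)%Z by move: ab; rewrite eb ea /letter; lia.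
  have H1 := around _ pP; have H2 := around _ (clP _ pP).
  have H3 := around _ qP; have H4 := around _ (clP _ qP).
  apply: H; [|by case: ev => ->; auto|lia..].
  by case: eu => ->; auto.
have clP' p : p \in P1 ++ P2 -> pi p \in P1 ++ P2.
  move=> hp; have pP : p \in P1 ++ [:: u, v & P2].
    by move: hp; rewrite !mem_cat !inE => /orP[]->; rewrite ?orbT.
  have un : p <> u /\ p <> v.
    split=> e; move: hp; rewrite e mem_cat => /orP[hp|hp].
    - by have := h1 u u hp (mem_head _ _); rewrite ltnn.
    - by have := h2 u hp; rewrite ltnn.
    - by have := h1 v v hp; rewrite !inE eqxx orbT ltnn => /(_ isT).
    - by have := h3 v hp; rewrite ltnn.
  have := clP p pP; rewrite !mem_cat !inE => /or4P[->//|/eqP e|/eqP e|->]; last by rewrite orbT.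
  - by case: un => _ []; rewrite -eqv -e piK.
  - by case: un => -[]; rewrite -[u]piK eqv -e piK.
have [|||IH1 IH2] := IH (P1 ++ P2) => //.
- by rewrite map_cat e1 e2.
- rewrite pairwise_cat sP1 sP2 !andbT; apply/allrelP => i j hi hj.
  by apply: h1 => //; rewrite !inE hj !orbT.
split.
- move=> d; rewrite in_setU1; split.
    case/orP=> [/eqP->|/IH1[p [pP lp ->]]]; first by exists u; rewrite uP eqv uv eb ea.
    exists p; split=> //; move: pP; rewrite !mem_cat !inE => /orP[]->; by rewrite ?orbT.
  case=> p [pP lp ->]; case: (eqVneq p u) => [->|pu]; first by rewrite eqv eb ea eqxx.
  apply/orP; right; apply/IH1; exists p; split=> //.
  move: pP; rewrite !mem_cat !inE (negPf pu) /= => /or3P[->//|/eqP e|->]; last by rewrite orbT.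
  by move: lp; rewrite e -eqv piK eqv ltnNge (ltnW uv).
- move=> x; split.
    by move=> /IH2[p [pP ep ->]]; exists p; split=> //; move: pP; rewrite !mem_cat !inE => /orP[]->; rewrite ?orbT.
  case=> p [pP ep ->]; apply/IH2; exists p; split=> //.
  move: pP; rewrite !mem_cat !inE => /or4P[->//|/eqP e|/eqP e|->]; last by rewrite orbT.
  - by move: uv; rewrite -eqv -e ep ltnn.
  - by move: uv; rewrite -[u]piK eqv -e ep ltnn.
Qed.

End Words.

(** * The shape of a word with a block structure *)

Section Shape.
Variable n : nat.
Implicit Types (w z : {perm pm n}) (x y : pm n) (p q : 'I_n) (pi : 'I_n -> 'I_n).

(** A letter is matched with the opposite of the other letter of its block. A one-letter block gives
    the pair of a letter and its opposite. *)
Definition shape_partner w pi x : pm n :=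
  let: (b, p) := (w^-1)%g x in pmopp (w (b, pi p)).

Definition partner_shape w z pi : {set {set pm n}} :=
  [set [set x; shape_partner w pi x] | x in negated_points z].

Lemma letterE w x : w \in signed_perms n ->
  exists b p, x = w (b, p) /\ zval x = (if b then (- letter w p)%Z else letter w p).
Proof.
move=> sw; exists ((w^-1)%g x).1, ((w^-1)%g x).2; rewrite -surjective_pairing permKV; split=> //.
case e : ((w^-1)%g x) => [b p] /=.
have -> : x = w (b, p) by rewrite -e permKV.
case: b {e}; rewrite // /letter -zval_opp -signedP //.
Qed.

Lemma shape_partnerE w pi b p : shape_partner w pi (w (b, p)) = pmopp (w (b, pi p)).
Proof. by rewrite /shape_partner permK. Qed.

Lemma signed_true w p : w \in signed_perms n -> w (true, p) = pmopp (w (false, p)).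
Proof. by move=> sw; rewrite -signedP. Qed.

Lemma block_sum_neq0 w z pi p : block_structure w z pi ->
  (letter w p + letter w (pi p) <> 0)%Z.
Proof.
case=> piK _ _ gb _; case: (leqP p (pi p)) => h; first by have [] := gb p h; lia.
by have [|] := gb (pi p); rewrite piK; [exact: ltnW | lia].
Qed.

(** * The matching of the points negated by z *)

Section Structure.
Variables (w z : {perm pm n}) (pi : 'I_n -> 'I_n).
Hypotheses (sw : w \in signed_perms n) (sz : z \in signed_perms n).
Hypothesis bs : block_structure w z pi.

Let piK : involutive pi. Proof. by case: bs. Qed.

(** In a block of positive sum, z sends a letter to a letter of the same word, and no two letters of
    a signed word are opposite. *)
Lemma negated_letter b p : (w (b, p) \in negated_points z) = (letter w p + letter w (pi p) <? 0)%Z.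
Proof.
have -> : (w (b, p) \in negated_points z) = (w (false, p) \in negated_points z).
  case: b => //; rewrite !inE signed_true // signedP // (eqtype.inj_eq (can_inj (@pmoppK n))) //.
rewrite inE; case: bs => _ zpos zneg _ _; have := block_sum_neq0 (p := p) bs.
case: Z.ltb_spec => [/zneg -> _|h h']; first exact: eqxx.
rewrite zpos; last by lia.
by rewrite -signedP //; apply/eqP => /perm_inj.
Qed.

Lemma shape_partnerK : involutive (shape_partner w pi).
Proof.
move=> x; have [b [p [-> _]]] := letterE x sw.
by rewrite shape_partnerE -signedP // shape_partnerE -signedP // /pmopp /= negbK piK.
Qed.

Lemma shape_partner_opp x : shape_partner w pi (pmopp x) = pmopp (shape_partner w pi x).
Proof.
have [b [p [-> _]]] := letterE x sw.
by rewrite -signedP // !shape_partnerE /= -!signedP.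
Qed.

Lemma shape_partner_negated x :
  (shape_partner w pi x \in negated_points z) = (x \in negated_points z).
Proof.
have [b [p [-> _]]] := letterE x sw.
by rewrite shape_partnerE -signedP // !negated_letter piK Z.add_comm.
Qed.

Lemma shape_partner_neq x : shape_partner w pi x <> x.
Proof.
have [b [p [-> _]]] := letterE x sw; rewrite shape_partnerE -signedP //.
by move/perm_inj => [] /eqP; case: b.
Qed.

Lemma partner_shape_block x B : B \in partner_shape w z pi -> x \in B ->
  x \in negated_points z /\ B = [set x; shape_partner w pi x].
Proof.
case/imsetP=> y yz ->; rewrite in_set2 => /orP[]/eqP->; split=> //.
  by rewrite shape_partner_negated.
by rewrite shape_partnerK setUC.
Qed.

Lemma partner_shape_pair x y : x <> y -> [set x; y] \in partner_shape w z pi ->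
  x \in negated_points z /\ y = shape_partner w pi x.
Proof.
move=> xy h; have [xz e] := partner_shape_block h (set21 x y); split=> //.
have : y \in [set x; shape_partner w pi x] by rewrite -e set22.
by rewrite !inE => /orP[]/eqP // yx; case: xy.
Qed.

Lemma partner_shape_noncrossing : noncrossing (partner_shape w z pi).
Proof.
apply/forallP=> i; apply/forallP=> j; apply/forallP=> k; apply/forallP=> l.
apply/implyP=> /and3P[/pmltP ij /pmltP jk /pmltP kl]; apply/negP=> /andP[ik jl].
have [iz ek] : i \in negated_points z /\ k = shape_partner w pi i.
  by apply: partner_shape_pair ik => e; subst; lia.
have [jz el] : j \in negated_points z /\ l = shape_partner w pi j.
  by apply: partner_shape_pair jl => e; subst; lia.
have block_of x : x \in negated_points z -> exists p b, [/\ p <= pi p,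
    x = w (b, p) \/ x = w (b, pi p) & (block_sum (block_at w pi p) < 0)%Z].
  have [b [p [-> _]]] := letterE x sw; rewrite negated_letter => /Z.ltb_spec0 h.
  have [p' [pp e1 e2]] := block_ends p bs; exists p', b; split=> //.
    by case: e1 => ->; rewrite ?piK; auto.
  by case: e1 => ->; rewrite /block_sum /= ?piK; lia.
have ends x p b : x = w (b, p) \/ x = w (b, pi p) -> let A := block_at w pi p in
    let y := shape_partner w pi x in
    (zval x = fval A /\ zval y = - lval A \/ zval x = - lval A /\ zval y = fval A \/
     zval x = - fval A /\ zval y = lval A \/ zval x = lval A /\ zval y = - fval A)%Z.
  case=> -> /=; rewrite shape_partnerE zval_opp ?piK /letter; case: b.
  - by rewrite !signed_true // !zval_opp Z.opp_involutive; do 2 right; left.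
  - by left.
  - by rewrite !signed_true // !zval_opp Z.opp_involutive; right; left.
  - by do 3 right.
have [p [b [pp ei np]]] := block_of i iz; have [q [c [qq ej nq]]] := block_of j jz.
have Ei := ends _ _ _ ei; have Ej := ends _ _ _ ej; rewrite -ek -el /= in Ei Ej.
case: (bs) => _ _ _ gb cb.
case: (eqVneq p q) => [e|/eqP pq]; last first.
  have qp : q <> p by move=> e; apply: pq.
  exact: neg_neg_noncrossing (gb p pp) (gb q qq) (disjoint_block_at sw piK pp qq pq)
    (cb p q pp qq pq) (cb q p qq pp qp) np nq Ei Ej ij jk kl.
(* Arcs of a single block: the arc from y to -x and its mirror image lie on the two sides of 0, or
   coincide when the block has one letter. *)
subst q; have [g1 g2] := gb p pp; move: np; rewrite /block_sum /= => np.
move: g1 g2 np Ei Ej ij jk kl; clear; lia.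
Qed.

Lemma partner_shape_NCSP : partner_shape w z pi \in NCSP z.
Proof.
rewrite inE; apply/and4P; split; last exact: partner_shape_noncrossing.
- apply/andP; split.
    apply/forall_inP=> B /imsetP[x xz ->]; apply/andP; split.
      by apply/subsetP=> y; rewrite in_set2 => /orP[]/eqP->; rewrite ?shape_partner_negated.
    by rewrite cards2; case: (x =P _) => // e; case: (shape_partner_neq (esym e)).
  apply/trivIsetP=> B C hB hC; apply: contraR => /pred0Pn[x /= /andP[xB xC]].
  have [_ eB] := partner_shape_block hB xB; have [_ eC] := partner_shape_block hC xC.
  by rewrite {1}eB {1}eC.
- apply/eqP/setP=> x; apply/bigcupP/idP; first by case=> B hB xB; have [] := partner_shape_block hB xB.
  by move=> xz; exists [set x; shape_partner w pi x]; [apply: imset_f | apply: set21].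
- apply/forallP=> i; apply/forallP=> j; apply/implyP => /imsetP[x xz e].
  have im a b : [set pmopp a; pmopp b] = [set pmopp y | y in [set a; b]] by rewrite imsetU1 imset_set1.
  rewrite im e -im -shape_partner_opp; apply: imset_f.
  have [b [p [ex _]]] := letterE x sw; move: xz; rewrite ex -signedP //.
  by rewrite !negated_letter.
Qed.

(** The first letter of a two-letter block is positive, so the condition 0 < a < b on a deleted pair
    (a, -b) says exactly that the sum of the block is negative. Likewise the negative letters that
    survive are the one-letter blocks negated by z. *)
Lemma shape_of_partner_shape D r : nested_descents (one_line w) D r ->
  shape_of D r = partner_shape w z pi.
Proof.
move=> nd.
have [|||hD hr] := nested_descents_pairs sw bs nd (P := enum 'I_n).
- by [].
- have := pairwise_map (@nat_of_ord n) (fun i j => i < j) (enum 'I_n).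
  rewrite val_enum_ord => <-; have := iota_ltn_sorted 0 n.
  by rewrite (sorted_pairwise ltn_trans).
- by move=> p _; rewrite mem_enum.
have pos x : (0 < pmval x)%R <-> (0 < zval x)%Z.
  by rewrite /pmval /zval; case: x => [[] i] /=; lia.
have neg x : (pmval x < 0)%R <-> (zval x < 0)%Z.
  by rewrite /pmval /zval; case: x => [[] i] /=; lia.
have ltv x y : (pmval x < pmval y)%R <-> (zval x < zval y)%Z.
  by split; [move/(pmltP x y) | move/(pmltP x y)].
have neg2 p : w (true, p) = pmopp (w (false, p)) by exact: signed_true.
apply/setP=> B; apply/idP/idP.
- rewrite !inE => /orP[/orP[]|] /imsetP[d + ->].
  + rewrite inE => /andP[/hD[p [_ lp ->]] /= /andP[/pos h1 /ltv]]; rewrite zval_opp => h2.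
    rewrite -(shape_partnerE w pi false p); apply: imset_f.
    by rewrite negated_letter; apply/Z.ltb_spec0; rewrite /letter; lia.
  + rewrite inE => /andP[/hD[p [_ lp ->]] /= /andP[/pos h1 /ltv]]; rewrite zval_opp => h2.
    have -> : w (false, pi p) = shape_partner w pi (w (true, p)).
      by rewrite shape_partnerE neg2 pmoppK.
    rewrite -neg2; apply: imset_f.
    by rewrite negated_letter; apply/Z.ltb_spec0; rewrite /letter; lia.
  + case/imsetP=> x; rewrite inE => /andP[/hr[p [_ ep ->]] /neg h] ->.
    rewrite -neg2 -{2}ep -(shape_partnerE w pi true p); apply: imset_f.
    by rewrite negated_letter ep; apply/Z.ltb_spec0; rewrite /letter; lia.
- case/imsetP=> x xz ->; have [b [p [ex _]]] := letterE x sw; subst x.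
  move: xz; rewrite negated_letter shape_partnerE => /Z.ltb_spec0 np.
  case: (bs) => _ _ _ gb _.
  have pair q : q < pi q -> (letter w q + letter w (pi q) < 0)%Z ->
     (w (false, q), w (false, pi q)) \in
       [set d in D | (0 < pmval d.1 < pmval (pmopp d.2))%R].
    move=> lq nq; rewrite inE; apply/andP; split; first by apply/hD; exists q; rewrite mem_enum.
    have [g1 g2] := gb q (ltnW lq); apply/andP; split=> /=.
      by apply/pos; move: g2; rewrite /letter; lia.
    by apply/ltv; rewrite zval_opp; move: np; rewrite /letter in nq *; lia.
  rewrite !inE; case: (ltngtP p (pi p)) => [lp|lp|/val_inj ep].
  + have hp := pair p lp np; case: b; apply/orP; left; apply/orP; [right|left].
      by apply/imsetP; exists (w (false, p), w (false, pi p)) => //=; rewrite !neg2 pmoppK.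
    by apply/imsetP; exists (w (false, p), w (false, pi p)).
  + have hp := pair (pi p); rewrite piK in hp; have {}hp := hp lp ltac:(lia).
    case: b; apply/orP; left; apply/orP; [left|right].
      by apply/imsetP; exists (w (false, pi p), w (false, p)) => //=; rewrite !neg2 pmoppK setUC.
    by apply/imsetP; exists (w (false, pi p), w (false, p)) => //=; rewrite setUC.
  + apply/orP; right; apply/imsetP; rewrite -ep.
    have h : w (true, p) \in abs_neg r.
      rewrite neg2; apply: imset_f; rewrite inE; apply/andP; split.
        by apply/hr; exists p; rewrite mem_enum.
      by apply/neg; rewrite -ep /letter in np *; lia.
    exists (w (true, p)) => //; case: b; first by [].
    by rewrite neg2 pmoppK setUC.
Qed.

End Structure.
End Shape.

(** * Length *)

Section Length.
Variable n : nat.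
Implicit Types (w z : {perm pm n}) (x y : pm n) (i : 'I_n).

Definition lower i : pm n := if i == 0 :> nat then (true, i) else (false, ord_predn i).
Definition upper i : pm n := (false, i).

Definition flipv (v : Z) : Z := if (v =? 1)%Z then (-1)%Z else if (v =? -1)%Z then 1%Z else v.

Lemma flipvP v : (v = 1 /\ flipv v = -1 \/ v = -1 /\ flipv v = 1 \/
  (v <> 1 /\ v <> -1) /\ flipv v = v)%Z.
Proof.
rewrite /flipv; case: Z.eqb_spec => h1; first by left.
by case: Z.eqb_spec => h2; right; [left | right].
Qed.

Lemma flipvK : involutive flipv.
Proof. by move=> v; case: (flipvP v) => [[-> ->]|[[-> ->]|[_ e]]] //; rewrite !e. Qed.

Lemma flipv_opp v : flipv (- v) = (- flipv v)%Z.
Proof. by have := flipvP v; have := flipvP (- v); lia. Qed.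

Lemma zval_simple_gen i x : zval (simple_gen i x) =
  if i == 0 :> nat then flipv (zval x) else swapv (Z.of_nat i) (zval x).
Proof.
rewrite /simple_gen; case: eqP => i0.
  rewrite /flipv; case: tpermP => [->|->|n1 n2].
  - by rewrite /zval /= i0.
  - by rewrite /zval /= i0.
  - case: Z.eqb_spec => h1; first by case: n2; apply: zval_inj; rewrite h1 /zval /= i0.
    case: Z.eqb_spec => h2 //; by case: n1; apply: zval_inj; rewrite h2 /zval /= i0.
have k0 : (0 < Z.of_nat i)%Z by lia.
rewrite /pmul permM.
have zt (a b : pm n) y : zval (tperm a b y) = if y == a then zval b else if y == b then zval a else zval y.
  case: tpermP => [->|->|]; first by rewrite eqxx.
    by rewrite eqxx; case: eqP => // ->.
  by do 2 move=> /eqP/negPf ->.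
rewrite !zt.
have inj_z (y : pm n) a : (y == a) = (zval y =? zval a)%Z.
  by apply/eqP/Z.eqb_spec => [->//|/zval_inj].
rewrite !inj_z !zt !inj_z.
have e1 : zval (false, ord_predn i) = Z.of_nat i by rewrite /zval /=; lia.
have e2 : zval (false, i) = (Z.of_nat i + 1)%Z by rewrite /zval /=; lia.
have e3 : zval (true, ord_predn i) = (- Z.of_nat i)%Z by rewrite /zval /=; lia.
have e4 : zval (true, i) = (- (Z.of_nat i + 1))%Z by rewrite /zval /=; lia.
rewrite e1 e2 e3 e4; move: (zval x) (Z.of_nat i) k0 => v k k0; rewrite /swapv; clear -k0.
case: (Z.eqb_spec v k) => h1; last case: (Z.eqb_spec v (k + 1)) => h2;
  last case: (Z.eqb_spec v (- k)) => h3; last case: (Z.eqb_spec v (- (k + 1))) => h4;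
  by repeat (case: Z.eqb_spec => ?; try lia).
Qed.

Lemma zval_bounds x : (zval x <> 0 /\ - Z.of_nat n <= zval x <= Z.of_nat n)%Z.
Proof. by case: x => [[] [i lt_in]]; rewrite /zval /=; lia. Qed.

Lemma simple_genK i : involutive (simple_gen i).
Proof.
move=> x; apply: zval_inj; rewrite !zval_simple_gen; have [x0 _] := zval_bounds x.
case: eqP => i0; first exact: flipvK.
have k0 : (0 < Z.of_nat i)%Z by lia.
case: (swapvP (zval x) k0) => [[ex ->]|[[ex ->]|[[ex ->]|[[ex ->]|[[? [? [? ?]]] ->]]]]].
- by rewrite swapv_k1.
- by rewrite swapv_k.
- by rewrite swapv_opp // swapv_k1.
- by rewrite swapv_opp // swapv_k.
- by apply: swapv_id.
Qed.

Lemma simple_gen_opp i x : simple_gen i (pmopp x) = pmopp (simple_gen i x).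
Proof.
apply: zval_inj; rewrite zval_opp !zval_simple_gen zval_opp.
case: eqP => i0; first exact: flipv_opp.
by rewrite swapv_opp //; lia.
Qed.

Lemma simple_gen_signed i : simple_gen i \in signed_perms n.
Proof. by rewrite inE; apply/forallP=> x; rewrite simple_gen_opp. Qed.

Lemma simple_genV i : (simple_gen i)^-1%g = simple_gen i.
Proof. by apply/permP=> x; apply: (@perm_inj _ (simple_gen i)); rewrite permKV simple_genK. Qed.

Lemma pmul_signed u v : u \in signed_perms n -> v \in signed_perms n -> pmul u v \in signed_perms n.
Proof. by move=> su sv; rewrite inE; apply/forallP=> x; rewrite /pmul !permM !signedP. Qed.

Lemma signedV w : w \in signed_perms n -> (w^-1)%g \in signed_perms n.
Proof.
move=> sw; rewrite inE; apply/forallP=> x; apply/eqP; apply: (@perm_inj _ w).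
by rewrite permKV signedP // permKV.
Qed.

Lemma simple_mulK i w : pmul (simple_gen i) (pmul (simple_gen i) w) = w.
Proof. by apply/permP=> x; rewrite /pmul !permM simple_genK. Qed.

Lemma zval_lower i : zval (lower i) = if i == 0 :> nat then (-1)%Z else Z.of_nat i.
Proof. by rewrite /lower /zval; case: eqP => /= [->|]; lia. Qed.

Lemma zval_upper i : zval (upper i) = (Z.of_nat i + 1)%Z.
Proof. by rewrite /upper /zval /=; lia. Qed.

Lemma simple_gen_lower i : simple_gen i (lower i) = upper i.
Proof.
apply: zval_inj; rewrite zval_simple_gen zval_lower zval_upper.
by case: eqP => [->//|_]; rewrite swapv_k.
Qed.

Lemma simple_gen_upper i : simple_gen i (upper i) = lower i.
Proof. by rewrite -simple_gen_lower simple_genK. Qed.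

Lemma lower_lt_upper i : pmlt (lower i) (upper i).
Proof. by apply/pmltP; rewrite zval_lower zval_upper; case: eqP; lia. Qed.

Lemma pmlt_opp x y : pmlt (pmopp x) (pmopp y) = pmlt y x.
Proof. by apply/pmltP/pmltP; rewrite !zval_opp; lia. Qed.

Lemma pmlt_asym x y : pmlt x y -> pmlt y x = false.
Proof. by move=> /pmltP h; apply/pmltP; lia. Qed.

Lemma pmlt_total x y : x <> y -> pmlt x y \/ pmlt y x.
Proof.
move=> xy; have : zval x <> zval y by move/zval_inj.
by move=> h; case: (Z.lt_total (zval x) (zval y)) => [?|[//|?]]; [left|right]; apply/pmltP.
Qed.

(** These are the increasing pairs whose order the generator reverses: a simple root, written as a
    pair of letters, and the same pair after negation. For i = 0 the two coincide. *)
Definition simple_root i x y := (x == lower i) && (y == upper i) ||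
  (x == pmopp (upper i)) && (y == pmopp (lower i)).

Lemma simple_gen_lt i x y : pmlt x y -> ~~ simple_root i x y ->
  pmlt (simple_gen i x) (simple_gen i y).
Proof.
have inj_z (u v : pm n) : (u == v) = (zval u =? zval v)%Z.
  by apply/eqP/Z.eqb_spec => [->//|/zval_inj].
move=> /pmltP xy; rewrite /simple_root !inj_z !zval_opp zval_lower zval_upper => nr.
apply/pmltP; rewrite !zval_simple_gen; have [x0 _] := zval_bounds x; have [y0 _] := zval_bounds y.
move: nr; case: eqP => i0.
  rewrite i0; case: (flipvP (zval x)) => [[ex ->]|[[ex ->]|[ex ->]]];
  case: (flipvP (zval y)) => [[ey ->]|[[ey ->]|[ey ->]]]; rewrite ?ex ?ey //=; lia.
have k0 : (0 < Z.of_nat i)%Z by lia.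
case: (swapv_lt (zval x) (zval y) k0) => [|[-> _]//].
by case=> -[ex ey]; rewrite ex ey ?Z.eqb_refl ?andbT ?orbT //; lia.
Qed.

Lemma simple_root_simple_gen i x y :
  simple_root i (simple_gen i x) (simple_gen i y) = simple_root i y x.
Proof.
have e a b : (simple_gen i a == b) = (a == simple_gen i b).
  by rewrite -{1}[b](simple_genK i) (eqtype.inj_eq perm_inj).
rewrite /simple_root !e !simple_gen_opp simple_gen_lower simple_gen_upper.
by congr orb; rewrite andbC.
Qed.

(** The generators act on the left, hence on letters, so the inverse compares the positions of the
    two letters. *)
Definition ascent i w := pmlt ((w^-1)%g (lower i)) ((w^-1)%g (upper i)).

(* Twice the length: up to negation of both letters every inversion is counted
   twice, except the pairs (-x, x), which get weight 2. *)
Definition weighted_inversions w : nat :=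
  \sum_(c : pm n * pm n | pmlt c.1 c.2 && pmlt ((w^-1)%g c.2) ((w^-1)%g c.1))
    (c.2 == pmopp c.1).+1.

Lemma pmulV (u v : {perm pm n}) : ((pmul u v)^-1 = pmul v^-1 u^-1)%g.
Proof. by rewrite /pmul invMg. Qed.

(** Applying the generator to both entries of a pair matches the inversions of the two permutations,
    except for the simple roots; these become inversions and contribute 2. *)
Lemma weighted_inversions_ascent i w : w \in signed_perms n -> ascent i w ->
  weighted_inversions (pmul (simple_gen i) w) = (weighted_inversions w).+2.
Proof.
move=> sw; set s := simple_gen i; set u := (w^-1)%g => asc.
have su : u \in signed_perms n by apply: signedV.
have sK : involutive s by apply: simple_genK.
have pK : involutive (fun c : pm n * pm n => (s c.1, s c.2)) by case=> a b /=; rewrite !sK.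
rewrite /weighted_inversions (reindex_inj (inv_inj pK)) /= pmulV simple_genV.
rewrite (eq_bigl (fun c => pmlt (s c.1) (s c.2) && pmlt (u c.2) (u c.1))); last first.
  by move=> c; rewrite /pmul !permM !sK.
rewrite (eq_bigr (fun c => (c.2 == pmopp c.1).+1)); last first.
  by move=> c _; rewrite -simple_gen_opp (eqtype.inj_eq perm_inj).
rewrite (bigID (fun c => simple_root i c.2 c.1)) /= -addn2 addnC; congr addn.
  apply: eq_bigl => -[x y] /=; case: (boolP (simple_root i y x)) => rt /=.
    rewrite andbF; apply/esym/negP => /andP[xy _]; move: rt; rewrite /simple_root.
    case/orP => /andP[/eqP ey /eqP ex]; move: xy; rewrite ex ey ?pmlt_opp pmlt_asym //;
      exact: lower_lt_upper.
  rewrite andbT; case uxy: (pmlt (u y) (u x)); rewrite ?andbF // !andbT.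
  apply/idP/idP => [sxy|xy].
    by rewrite -[x]sK -[y]sK; apply: simple_gen_lt sxy _; rewrite simple_root_simple_gen.
  apply: simple_gen_lt xy _; apply/negP; rewrite /simple_root.
  by case/orP=> /andP[/eqP ex /eqP ey]; move: uxy; rewrite ex ey ?signedP // ?pmlt_opp pmlt_asym.
rewrite (eq_bigl (fun c => simple_root i c.2 c.1)); last first.
  case=> x y /=; case: (boolP (simple_root i y x)) => rt; rewrite ?andbF // andbT.
  case/orP: rt => /andP[/eqP -> /eqP ->]; rewrite ?simple_gen_opp ?signedP // ?pmlt_opp.
    by rewrite simple_gen_lower simple_gen_upper lower_lt_upper.
  by rewrite simple_gen_lower simple_gen_upper lower_lt_upper.
(* For i = 0 there is a single pair, of weight 2; otherwise there are two pairs of weight 1. *)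
case: (eqVneq (lower i) (pmopp (upper i))) => e.
  rewrite (big_pred1 (upper i, lower i)) /=; first by rewrite e eqxx.
  by case=> x y; rewrite /simple_root e pmoppK orbb /= xpair_eqE andbC.
rewrite (bigD1 (upper i, lower i)) /simple_root ?eqxx //= (negPf e).
rewrite (big_pred1 (pmopp (lower i), pmopp (upper i))) /=.
  by rewrite pmoppK eq_sym (negPf e).
case=> x y; rewrite /= !xpair_eqE.
case: (eqVneq y (lower i)) => [->|_]; case: (eqVneq x (upper i)) => [->|_] //=; rewrite ?andbF ?andbT ?orbF //=.
- by rewrite (negPf e) andbF.
- by rewrite (negPf e) andbF.
- by rewrite andbC.
- by rewrite andbC.
Qed.

End Length.

(** * Reduced words and the Coxeter length *)

Section Demazure.
Variable n : nat.
Implicit Types (u v w z : {perm pm n}) (x y : pm n) (i : 'I_n).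

Lemma ascent_simple_gen i w : ascent i (pmul (simple_gen i) w) = ~~ ascent i w.
Proof.
rewrite /ascent pmulV simple_genV /pmul !permM simple_gen_lower simple_gen_upper.
case: (pmlt_total (x := (w^-1)%g (lower i)) (y := (w^-1)%g (upper i))).
- by move/perm_inj => e; have := lower_lt_upper i; rewrite e; move/pmltP; lia.
- by move=> h; rewrite h pmlt_asym.
- by move=> h; rewrite h pmlt_asym.
Qed.

Lemma weighted_inversions_descent i w : w \in signed_perms n -> ~~ ascent i w ->
  weighted_inversions w = (weighted_inversions (pmul (simple_gen i) w)).+2.
Proof.
move=> sw; rewrite -ascent_simple_gen => asc.
rewrite -[in LHS](simple_mulK i w); apply: weighted_inversions_ascent => //.
by apply: pmul_signed => //; apply: simple_gen_signed.
Qed.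

Lemma weighted_inversions1 : weighted_inversions (1%g : {perm pm n}) = 0.
Proof.
rewrite /weighted_inversions big_pred0 // => c; rewrite invg1 !perm1.
by case: (boolP (pmlt c.1 c.2)) => //= h; rewrite pmlt_asym.
Qed.

(** The inverse of w increases along -1, 1, 2, ..., n. It is thus positive at 1, which bounds its
    values from below going up, and the largest letter bounds them from above going down. *)
Lemma all_ascents w : w \in signed_perms n -> (forall i, ascent i w) -> w = 1%g.
Proof.
move=> sw asc; pose f (i : 'I_n) := zval ((w^-1)%g (upper i)).
have lb k : forall i : 'I_n, i = k :> nat -> (Z.of_nat k + 1 <= f i)%Z.
  elim: k => [|k IH] i ik; have /pmltP := asc i; rewrite -/(f i) /lower ik /=.
    rewrite (_ : (true, i) = pmopp (upper i)) // signedP ?signedV // zval_opp -/(f i).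
    by lia.
  have := IH (ord_predn i); rewrite -/(upper (ord_predn i)) -/(f _) /= ik => /(_ erefl); lia.
have ub k : forall i : 'I_n, (i + k).+1 = n -> (f i <= Z.of_nat i + 1)%Z.
  elim: k => [|k IH] i ik; first by have [_] := zval_bounds ((w^-1)%g (upper i)); rewrite -/(f i); lia.
  have lt_j : i.+1 < n by lia.
  have /pmltP := asc (Ordinal lt_j); rewrite -/(f _) /lower /=.
  have -> : (false, ord_predn (Ordinal lt_j)) = upper i by congr pair; apply: val_inj.
  by have := IH (Ordinal lt_j); rewrite /= -/(f i); lia.
have fix_upper i : (w^-1)%g (upper i) = upper i.
  apply: zval_inj; rewrite zval_upper; have := lb i i erefl.
  have := ub (n - i.+1) i; rewrite -/(f i); have := ltn_ord i; lia.
apply/permP => x; rewrite perm1; apply: (@perm_inj _ (w^-1)%g); rewrite permK.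
case: x => [[] i]; last by rewrite fix_upper.
by rewrite (_ : (true, i) = pmopp (upper i)) // signedP ?signedV // fix_upper.
Qed.

Lemma reduced_word w : w \in signed_perms n ->
  exists s : seq 'I_n, word_prod s = w /\ weighted_inversions w = 2 * size s.
Proof.
have [m] := ubnP (weighted_inversions w); elim: m w => // m IH w lt_m sw.
case: (boolP [forall i, ascent i w]) => [/forallP asc|].
  by exists [::]; rewrite (all_ascents sw asc) weighted_inversions1 muln0.
rewrite negb_forall => /existsP[i dsc]; have e := weighted_inversions_descent sw dsc.
have [||s [ws es]] := IH (pmul (simple_gen i) w); first by lia.
  by apply: pmul_signed => //; apply: simple_gen_signed.
by exists (i :: s); rewrite /= ws simple_mulK; split=> //; rewrite e es; lia.
Qed.

Lemma word_prod_signed (s : seq 'I_n) : word_prod s \in signed_perms n.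
Proof.
elim: s => [|i s IH] /=; first by rewrite inE; apply/forallP=> x; rewrite !perm1.
by apply: pmul_signed => //; apply: simple_gen_signed.
Qed.

Lemma weighted_inversions_simple i w : w \in signed_perms n ->
  weighted_inversions (pmul (simple_gen i) w) <= (weighted_inversions w).+2 /\
  weighted_inversions w <= (weighted_inversions (pmul (simple_gen i) w)).+2.
Proof.
move=> sw; case: (boolP (ascent i w)) => h.
  by rewrite weighted_inversions_ascent //; lia.
by rewrite (weighted_inversions_descent sw h); lia.
Qed.

Lemma weighted_inversions_word (s : seq 'I_n) : weighted_inversions (word_prod s) <= 2 * size s.
Proof.
elim: s => [|i s IH] /=; first by rewrite weighted_inversions1.
by have [] := weighted_inversions_simple i (word_prod_signed s); lia.
Qed.

Lemma bigmin_leq (T : eqType) (s : seq T) (P : pred T) (F : T -> nat) (m : nat) (x : T) :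
  x \in s -> P x -> \big[minn/m]_(y <- s | P y) F y <= F x.
Proof.
elim: s => // y s IH; rewrite inE big_cons => /orP[/eqP->|xs] Px.
  by rewrite Px geq_minl.
by case: (P y); rewrite ?geq_min IH ?orbT.
Qed.

(** The minimum in [cox_length] runs only over sizes below the order of the group. The suffixes of a
    reduced word have distinct numbers of inversions, hence distinct products, so its size is in
    that range. *)
Lemma reduced_word_size (s : seq 'I_n) : weighted_inversions (word_prod s) = 2 * size s ->
  size s < #|signed_perms n|.
Proof.
move=> es; pose f (k : 'I_(size s).+1) := word_prod (drop k s).
have Lf k : k <= size s -> weighted_inversions (word_prod (drop k s)) = 2 * (size s - k).
  elim: k => [|k IH] hk; first by rewrite drop0 es subn0.
  have i0 : 'I_n by case: s hk {es f IH}.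
  have := IH (ltnW hk); rewrite (drop_nth i0) //= => e.
  have [h _] := weighted_inversions_simple (nth i0 s k) (word_prod_signed (drop k.+1 s)).
  have := weighted_inversions_word (drop k.+1 s); rewrite size_drop; lia.
have inj_f : injective f.
  move=> j k /(congr1 (@weighted_inversions n)); rewrite /f !Lf -1?ltnS ?ltn_ord // => e.
  by apply: val_inj => /=; have := ltn_ord j; have := ltn_ord k; lia.
have /subset_leq_card : codom f \subset signed_perms n.
  by apply/subsetP => w /codomP[k ->]; apply: word_prod_signed.
by rewrite card_codom // card_ord.
Qed.

(** Removing descents one by one yields a word of half this size, and no word is shorter because
    each generator changes the count by at most 2. *)
Lemma weighted_inversionsE w : w \in signed_perms n -> weighted_inversions w = 2 * cox_length w.
Proof.
move=> sw; have [s [ws es]] := reduced_word sw.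
have lt_s : size s < #|signed_perms n| by apply: reduced_word_size; rewrite ws.
suff -> : cox_length w = size s by [].
apply/eqP; rewrite eqn_leq /cox_length; apply/andP; split.
  apply: (bigmin_leq _ _ (x := Ordinal lt_s)); first by rewrite mem_index_enum.
  by apply/existsP; exists (in_tuple s); rewrite /= ws.
apply: (big_ind (fun m => size s <= m)) => [|x y hx hy|k /existsP[t /eqP wt]]; first exact: ltnW.
  by rewrite leq_min hx.
by have := weighted_inversions_word t; rewrite wt es size_tuple; lia.
Qed.

Lemma pmulA u v w : pmul u (pmul v w) = pmul (pmul u v) w.
Proof. by rewrite /pmul mulgA. Qed.

Lemma word_prod_cat (s t : seq 'I_n) : word_prod (s ++ t) = pmul (word_prod s) (word_prod t).
Proof. by elim: s => [|i s IH] /=; rewrite /pmul ?mulg1 // IH /pmul mulgA. Qed.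

Lemma word_prod_rev (s : seq 'I_n) : word_prod (rev s) = ((word_prod s)^-1)%g.
Proof.
elim: s => [|i s IH]; first by rewrite /= invg1.
by rewrite rev_cons -cats1 word_prod_cat IH /= pmulV simple_genV /pmul mul1g.
Qed.

Lemma cox_lengthV w : w \in signed_perms n -> cox_length (w^-1)%g = cox_length w.
Proof.
move=> sw; have le v : v \in signed_perms n -> cox_length (v^-1)%g <= cox_length v.
  move=> sv; have [s [ws es]] := reduced_word sv.
  have := weighted_inversions_word (rev s); rewrite word_prod_rev ws size_rev -es.
  by rewrite !weighted_inversionsE ?signedV //; lia.
by apply/eqP; rewrite eqn_leq le //= -{1}[w]invgK le ?signedV.
Qed.

Lemma cox_length_ascent i w : w \in signed_perms n -> ascent i w ->
  cox_length (pmul (simple_gen i) w) = (cox_length w).+1.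
Proof.
move=> sw asc; have := weighted_inversions_ascent sw asc.
rewrite !weighted_inversionsE //; first by lia.
by apply: pmul_signed => //; apply: simple_gen_signed.
Qed.

Lemma cox_length1 : cox_length (1%g : {perm pm n}) = 0.
Proof.
have := weighted_inversions1; rewrite weighted_inversionsE; first by lia.
exact: word_prod_signed [::].
Qed.

Lemma cox_length_simple i : cox_length (simple_gen i) = 1.
Proof.
have := @cox_length_ascent i 1%g; rewrite cox_length1 /pmul mul1g; apply.
  exact: word_prod_signed [::].
by rewrite /ascent invg1 !perm1 lower_lt_upper.
Qed.

End Demazure.

(** * Demazure product and involution words *)

Section Path.
Variable n : nat.
Implicit Types (u v w z : {perm pm n}) (x y : pm n) (i : 'I_n).

(* For an ascent i of z, [simple_root] holds of the images of the letters
   exchanged by the generator s exactly when s commutes with z. *)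
Inductive involution_path : {perm pm n} -> {perm pm n} -> Prop :=
| PathOne : involution_path 1%g 1%g
| PathStep i w z : involution_path w z -> ascent i w -> ascent i z ->
    involution_path (pmul (simple_gen i) w)
      (if simple_root i (z (lower i)) (z (upper i)) then pmul (simple_gen i) z
       else pmul (simple_gen i) (pmul z (simple_gen i))).

Lemma simple_gen_id i x : x <> lower i -> x <> upper i -> x <> pmopp (lower i) ->
  x <> pmopp (upper i) -> simple_gen i x = x.
Proof.
have ne y : x <> y -> zval x <> zval y by move=> h /zval_inj.
move=> /ne + /ne + /ne + /ne; rewrite !zval_opp zval_lower zval_upper => n1 n2 n3 n4.
apply: zval_inj; rewrite zval_simple_gen; case: eqP n1 n2 n3 n4 => i0 n1 n2 n3 n4.
  by case: (flipvP (zval x)); lia.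
by apply: swapv_id; lia.
Qed.

Lemma simple_root_images i z : simple_root i (z (lower i)) (z (upper i)) ->
  (z (lower i) = lower i /\ z (upper i) = upper i) \/
  (z (lower i) = pmopp (upper i) /\ z (upper i) = pmopp (lower i)).
Proof. by case/orP=> /andP[/eqP e1 /eqP e2]; [left | right]. Qed.

Lemma simple_root_commute i z x : z \in signed_perms n ->
  simple_root i (z (lower i)) (z (upper i)) -> z (simple_gen i x) = simple_gen i (z x).
Proof.
move=> sz rt; have zi := simple_root_images rt.
have ends y : y = lower i \/ y = upper i -> z (simple_gen i y) = simple_gen i (z y).
  case=> ->; rewrite ?simple_gen_lower ?simple_gen_upper;
  by case: zi => -[-> ->]; rewrite ?simple_gen_opp ?simple_gen_lower ?simple_gen_upper.
case: (eqVneq x (lower i)) => [|/eqP x1]; first by auto.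
case: (eqVneq x (upper i)) => [|/eqP x2]; first by auto.
case: (eqVneq x (pmopp (lower i))) => [->|/eqP x3].
  by rewrite simple_gen_opp !(signedP _ sz) simple_gen_opp ends; auto.
case: (eqVneq x (pmopp (upper i))) => [->|/eqP x4].
  by rewrite simple_gen_opp !(signedP _ sz) simple_gen_opp ends; auto.
rewrite simple_gen_id // [RHS]simple_gen_id //.
- by case: zi => -[e1 e2] e; [apply: x1 | apply: x4]; apply: (@perm_inj _ z); rewrite e ?signedP // ?e1 ?e2 ?pmoppK.
- by case: zi => -[e1 e2] e; [apply: x2 | apply: x3]; apply: (@perm_inj _ z); rewrite e ?signedP // ?e1 ?e2 ?pmoppK.
- by case: zi => -[e1 e2] e; [apply: x3 | apply: x2]; apply: (@perm_inj _ z); rewrite e ?signedP // ?e1 ?e2 ?pmoppK.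
- by case: zi => -[e1 e2] e; [apply: x4 | apply: x1]; apply: (@perm_inj _ z); rewrite e ?signedP // ?e1 ?e2 ?pmoppK.
Qed.

Lemma path_signed w z : involution_path w z ->
  [/\ w \in signed_perms n, z \in signed_perms n & (z^-1)%g = z].
Proof.
elim=> {w z} [|i w z _ [sw sz iz] asc_w asc_z].
  by rewrite invg1; split=> //; rewrite inE; apply/forallP=> x; rewrite !perm1.
have ss := simple_gen_signed i.
split; first exact: pmul_signed.
  by case: ifP => _; apply: pmul_signed => //; apply: pmul_signed.
case: ifP => rt; rewrite !pmulV simple_genV iz ?pmulA //.
by apply/permP=> x; rewrite /pmul !permM simple_root_commute.
Qed.

(** * Demazure products with a generator, and the inverse atoms *)

Section Product.
Variable dem : {perm pm n} -> {perm pm n} -> {perm pm n}.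
Hypothesis hdem : is_demazure_product dem.

Lemma dem_ascent i v : v \in signed_perms n -> ascent i v ->
  dem (simple_gen i) v = pmul (simple_gen i) v.
Proof.
move=> sv asc; case: hdem => _ _ _; apply=> //; first exact: simple_gen_signed.
by rewrite cox_length_ascent // cox_length_simple.
Qed.

(** Write v as the Demazure product of the generator with a shorter element; associativity and
    idempotence absorb the second copy. *)
Lemma dem_descent i v : v \in signed_perms n -> ~~ ascent i v ->
  dem (simple_gen i) v = v.
Proof.
move=> sv dsc; have ss := simple_gen_signed i.
have sv' : pmul (simple_gen i) v \in signed_perms n by apply: pmul_signed.
have e : dem (simple_gen i) (pmul (simple_gen i) v) = v.
  by rewrite dem_ascent ?simple_mulK // ascent_simple_gen.
case: hdem => _ dA dI _.
by rewrite -[in LHS]e dA // dI.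
Qed.

Lemma dem_ascentr i v : v \in signed_perms n -> ascent i (v^-1)%g ->
  dem v (simple_gen i) = pmul v (simple_gen i).
Proof.
move=> sv asc; have ss := simple_gen_signed i.
case: hdem => _ _ _; apply=> //.
rewrite -cox_lengthV; last exact: pmul_signed.
by rewrite pmulV simple_genV cox_length_ascent ?signedV // cox_lengthV // cox_length_simple addn1.
Qed.

Lemma dem_descentr i v : v \in signed_perms n -> ~~ ascent i (v^-1)%g ->
  dem v (simple_gen i) = v.
Proof.
move=> sv dsc; have ss := simple_gen_signed i.
have sv' : pmul v (simple_gen i) \in signed_perms n by apply: pmul_signed.
have e : dem (pmul v (simple_gen i)) (simple_gen i) = v.
  rewrite dem_ascentr //; last by rewrite pmulV simple_genV ascent_simple_gen.
  by apply/permP=> x; rewrite /pmul !permM simple_genK.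
case: hdem => _ dA dI _.
by rewrite -[in LHS]e -dA // dI.
Qed.

Lemma dem_simple_inverse i v : v \in signed_perms n ->
  [/\ dem (simple_gen i) v \in signed_perms n,
      ((dem (simple_gen i) v)^-1)%g = dem (v^-1)%g (simple_gen i)
    & cox_length (dem (simple_gen i) v) <= (cox_length v).+1].
Proof.
move=> sv; have ss := simple_gen_signed i; have sv' := signedV sv.
case: (boolP (ascent i v)) => asc.
  rewrite dem_ascent // dem_ascentr ?invgK // pmulV simple_genV cox_length_ascent //.
  by split=> //; apply: pmul_signed.
by rewrite dem_descent // dem_descentr ?invgK //; split.
Qed.

Lemma inv_atom_path w z : w \in signed_perms n -> dem w (w^-1)%g = z ->
  (forall v, v \in signed_perms n -> dem v (v^-1)%g = z -> cox_length w <= cox_length v) ->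
  involution_path w z.
Proof.
have [m] := ubnP (cox_length w); elim: m w z => // m IH w z lt_m sw wz min_w.
have s1 : (1%g : {perm pm n}) \in signed_perms n by apply: word_prod_signed [::].
case: (boolP [forall i, ascent i w]) => [/forallP asc|].
  move: wz; rewrite (all_ascents sw asc) invg1 => <-.
  suff -> : dem 1%g 1%g = 1%g by apply: PathOne.
  case: hdem => _ _ _ h; have := h 1%g 1%g s1 s1; rewrite /pmul mulg1 => -> //.
  by rewrite cox_length1.
rewrite negb_forall => /existsP[i dsc]; have ss : simple_gen i \in signed_perms n := simple_gen_signed i.
pose w' := pmul (simple_gen i) w; have sw' : w' \in signed_perms n by apply: pmul_signed.
have asc_w' : ascent i w' by rewrite ascent_simple_gen.
have ew : w = pmul (simple_gen i) w' by rewrite /w' simple_mulK.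
have cw : cox_length w = (cox_length w').+1 by rewrite ew cox_length_ascent.
pose z' := dem w' (w'^-1)%g.
case: (hdem) => dS dA _ _.
have conj v : v \in signed_perms n -> dem (dem (simple_gen i) v) ((dem (simple_gen i) v)^-1)%g = dem (dem (simple_gen i) (dem v (v^-1)%g)) (simple_gen i).
  move=> sv; have [sd -> _] := dem_simple_inverse i sv; have sv' := signedV sv.
  by rewrite !dA // dS.
have ez : z = dem (dem (simple_gen i) z') (simple_gen i) by rewrite -conj // -wz {1 2}ew dem_ascent.
(* The element w' is minimal for z': multiplying any v for z' by the generator gives an element for
   z, of length at most one more. *)
have pw : involution_path w' z'.
  apply: IH => //; first by rewrite -ltnS -cw.
  move=> v sv ev; have [sd _ le_d] := dem_simple_inverse i sv.
  by rewrite -ltnS -cw; apply: leq_trans (min_w _ sd _) le_d; rewrite conj // ev.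
have [_ sz' iz'] := path_signed pw.
(* At a descent of z' both products are absorbed, so z = z' and w' contradicts the minimality of
   w. *)
case: (boolP (ascent i z')) => asc_z'; last first.
  have e : z = z' by rewrite ez dem_descent // dem_descentr ?iz'.
  by have := min_w w' sw' (esym e); rewrite cw ltnn.
suff -> : z = if simple_root i (z' (lower i)) (z' (upper i)) then pmul (simple_gen i) z' else pmul (simple_gen i) (pmul z' (simple_gen i)).
  by rewrite [in X in involution_path X _]ew; apply: PathStep.
have ssz : pmul (simple_gen i) z' \in signed_perms n by apply: pmul_signed.
(* The generator reverses the two images only when they form a simple root, the commuting case; the
   right factor is then absorbed. *)
have asc_zs : ascent i (pmul z' (simple_gen i)) = ~~ simple_root i (z' (lower i)) (z' (upper i)).
  rewrite /ascent pmulV simple_genV iz' /pmul !permM.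
  move: asc_z'; rewrite /ascent iz' => lt_z; case: (boolP (simple_root i _ _)) => rt /=.
    case: (simple_root_images rt) => -[-> ->];
    by rewrite ?simple_gen_opp simple_gen_lower simple_gen_upper ?pmlt_opp pmlt_asym // lower_lt_upper.
  exact: simple_gen_lt.
rewrite ez dem_ascent //; case: ifP asc_zs => rt asc_zs.
  by rewrite dem_descentr // pmulV simple_genV iz' asc_zs.
by rewrite dem_ascentr ?pmulA // pmulV simple_genV iz' asc_zs.
Qed.

End Product.

Lemma inv_atoms_path dem z w : is_demazure_product dem -> w \in inv_atoms dem z -> involution_path w z.
Proof.
move=> hdem /imsetP[v + ->]; rewrite inE => /and3P[sv /eqP vz /forallP minv].
apply: (inv_atom_path hdem); rewrite ?signedV ?invgK // => x sx xz.
rewrite cox_lengthV // -[in leqRHS]cox_lengthV //.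
by have := minv (x^-1)%g; rewrite signedV //= invgK xz eqxx.
Qed.

End Path.

(** * Block structure along an involution word *)

Section Induction.
Variable n : nat.
Implicit Types (u v w z : {perm pm n}) (x y : pm n) (p q : 'I_n) (pi : 'I_n -> 'I_n).

Lemma block_structure_one : block_structure (1%g : {perm pm n}) 1%g id.
Proof.
have le p : letter (1%g : {perm pm n}) p = (Z.of_nat p + 1)%Z.
  by rewrite /letter perm1 /zval /=; lia.
split=> // [p|p|p _|p q _ _ pq]; rewrite ?perm1 //.
- by rewrite !le; lia.
- by rewrite /block_at /good_block !le; lia.
- rewrite /block_at !le /compatible /block_sum /=; split; last by split; lia.
  by move=> _ _; split; lia.
Qed.

(** * One step of an involution path *)

Section Step.
Variables (i : 'I_n) (w z : {perm pm n}) (pi : 'I_n -> 'I_n).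
Hypotheses (sw : w \in signed_perms n) (sz : z \in signed_perms n) (iz : (z^-1)%g = z).
Hypotheses (asc_w : ascent i w) (asc_z : ascent i z).
Hypothesis bs : block_structure w z pi.

Let piK : involutive pi. Proof. by case: bs. Qed.

Let s := simple_gen i.

Let lt_z : pmlt (z (lower i)) (z (upper i)).
Proof. by move: asc_z; rewrite /ascent iz. Qed.

Lemma letter_simple p : letter (pmul s w) p =
  if i == 0 :> nat then flipv (letter w p) else swapv (Z.of_nat i) (letter w p).
Proof. by rewrite /letter /pmul permM zval_simple_gen. Qed.

Definition links u v pi' := forall p,
  ((0 < letter u p + letter u (pi' p))%Z -> v (u (false, p)) = u (false, pi' p)) /\
  ((letter u p + letter u (pi' p) < 0)%Z -> v (u (false, p)) = pmopp (u (false, p))).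

Lemma structure_links : links w z pi.
Proof. by case: bs => _ h1 h2 _ _ p; split; [apply: h1 | apply: h2]. Qed.

(** Conjugation moves the letters and z together, so only a change of sign of some sum could break a
    link. *)
Lemma links_conj :
  (forall p, (0 < letter (pmul s w) p + letter (pmul s w) (pi p) ->
     0 < letter w p + letter w (pi p))%Z /\
    (letter (pmul s w) p + letter (pmul s w) (pi p) < 0 ->
     letter w p + letter w (pi p) < 0)%Z) ->
  links (pmul s w) (pmul s (pmul z s)) pi.
Proof.
move=> sgn p; have [h1 h2] := sgn p; have [l1 l2] := structure_links p.
rewrite /pmul !permM simple_genK; split=> h.
  by rewrite l1 //; apply: h1.
by rewrite l2 ?simple_gen_opp //; apply: h2.
Qed.

Lemma root_image x : simple_root i (z (lower i)) (z (upper i)) -> pmul s z (s x) = z x.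
Proof. by move=> rt; rewrite /pmul permM simple_root_commute // simple_genK. Qed.

Lemma position_of x : exists b p, x = w (b, p).
Proof. by have [b [p [e _]]] := letterE x sw; exists b, p. Qed.

Lemma simple_gen_other p0 q0 b c p : lower i = w (b, p0) -> upper i = w (c, q0) ->
  p <> p0 -> p <> q0 -> s (w (false, p)) = w (false, p).
Proof.
move=> e1 e2 n1 n2.
by apply: simple_gen_id; rewrite ?e1 ?e2 -?signedP // => /perm_inj[] //; case.
Qed.

(** The product of the generator and z sends the new letter at p to the same image as z sends the
    old one, by [root_image], so only the positions of the exchanged letters need care. For i = 0
    these coincide and p0 = q0. *)
Lemma links_root p0 q0 b c pi' : lower i = w (b, p0) -> upper i = w (c, q0) ->
  simple_root i (z (lower i)) (z (upper i)) ->
  (forall p, p <> p0 -> p <> q0 -> [/\ pi' p = pi p, pi p <> p0 & pi p <> q0]) ->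
  (forall p, p = p0 \/ p = q0 ->
    ((0 < letter (pmul s w) p + letter (pmul s w) (pi' p))%Z ->
       z (w (false, p)) = s (w (false, pi' p))) /\
    ((letter (pmul s w) p + letter (pmul s w) (pi' p) < 0)%Z ->
       z (w (false, p)) = pmopp (s (w (false, p))))) ->
  links (pmul s w) (pmul s z) pi'.
Proof.
move=> e1 e2 rt other special p.
have eqs q : pmul s w (false, q) = s (w (false, q)) by rewrite /pmul permM.
rewrite !eqs root_image //.
case: (eqVneq p p0) => [ep|/eqP n1]; first by apply: special; left.
case: (eqVneq p q0) => [ep|/eqP n2]; first by apply: special; right.
have [-> n3 n4] := other p n1 n2.
rewrite /letter !eqs !(simple_gen_other e1 e2) //; exact: structure_links.
Qed.

Lemma zval_image p : zval (z (w (false, p))) = letter_image (letter w p) (letter w (pi p)).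
Proof.
have [h1 h2] := structure_links p; have h0 := block_sum_neq0 (p := p) bs.
rewrite /letter_image; case: Z.ltb_spec => h; first by rewrite h1.
by rewrite h2 ?zval_opp //; lia.
Qed.

(** The ascent of w orders the positions and the ascent of z the images. Letters i and -(i + 1) are
    impossible, since the inverse of w would send i to a positive and i + 1 to a negative point. *)
Lemma ascending_position p q : i != 0 :> nat ->
  ascending_letters (Z.of_nat i) (Z.of_nat p) (letter w p) (zval (z (w (false, p))))
    (Z.of_nat q) (letter w q) (zval (z (w (false, q)))).
Proof.
move=> i0; have zl : zval (lower i) = Z.of_nat i by rewrite zval_lower (negPf i0).
have zu := zval_upper i.
have pt r : w (true, r) = pmopp (w (false, r)) by exact: signed_true.
have wl b r : lower i = w (b, r) -> (w^-1)%g (lower i) = (b, r) by move->; rewrite permK.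
have wu b r : upper i = w (b, r) -> (w^-1)%g (upper i) = (b, r) by move->; rewrite permK.
have l1 r : letter w r = Z.of_nat i -> lower i = w (false, r).
  by move=> e; apply: zval_inj; rewrite zl -e.
have l2 r : letter w r = (- Z.of_nat i)%Z -> lower i = w (true, r).
  by move=> e; apply: zval_inj; rewrite zl pt zval_opp -/(letter w r); lia.
have u1 r : letter w r = (Z.of_nat i + 1)%Z -> upper i = w (false, r).
  by move=> e; apply: zval_inj; rewrite zu -e.
have u2 r : letter w r = (- (Z.of_nat i + 1))%Z -> upper i = w (true, r).
  by move=> e; apply: zval_inj; rewrite zu pt zval_opp -/(letter w r); lia.
move: asc_w lt_z; rewrite /ascent.
split; last split; last split.
- move=> /l1 e1 /u1 e2; move: asc_w lt_z; rewrite /ascent (wl _ _ e1) (wu _ _ e2) e1 e2.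
  by move=> /pmltP h /pmltP h'; split=> //; move: h; rewrite /zval /=; lia.
- by move=> /l1 e1 /u2 e2; move: asc_w; rewrite /ascent (wl _ _ e1) (wu _ _ e2) => /pmltP; rewrite /zval /=; lia.
- move=> /l2 e1 /u1 e2; move: lt_z; rewrite e1 e2 pt signedP // => /pmltP.
  by rewrite zval_opp.
- move=> /l2 e1 /u2 e2; move: asc_w lt_z; rewrite /ascent (wl _ _ e1) (wu _ _ e2) e1 e2.
  rewrite !pt !signedP // pmlt_opp => /pmltP h /pmltP h'; split=> //.
  by move: h; rewrite /zval /=; lia.
Qed.

Lemma ascending_block_at p q : i != 0 :> nat ->
  ascending_blocks (Z.of_nat i) (block_at w pi p) (block_at w pi q).
Proof.
move=> i0; have h r t := ascending_position r t i0.
rewrite /ascending_blocks /block_at /=.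
have := h p q; have := h (pi p) q; have := h p (pi q); have := h (pi p) (pi q).
by rewrite !zval_image !piK; split; split.
Qed.

Lemma step_swap : i != 0 :> nat ->
  ~ (z (lower i) = lower i /\ z (upper i) = upper i) ->
  block_structure (pmul s w)
    (if simple_root i (z (lower i)) (z (upper i)) then pmul s z else pmul s (pmul z s)) pi.
Proof.
move=> i0 nfix; have k0 : (0 < Z.of_nat i)%Z by lia.
case: (bs) => _ _ _ gb cb.
have blockE p : block_at (pmul s w) pi p = swap_block (Z.of_nat i) (block_at w pi p).
  by rewrite /block_at /= !letter_simple (negPf i0).
have zl : zval (lower i) = Z.of_nat i by rewrite zval_lower (negPf i0).
have zu := zval_upper i.
have nomerge p q : pi p = p -> pi q = q -> letter w p = Z.of_nat i ->
    letter w q = (Z.of_nat i + 1)%Z -> False.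
  move=> ep eq yp yq; apply: nfix.
  have el : lower i = w (false, p) by apply: zval_inj; rewrite zl -yp.
  have eu : upper i = w (false, q) by apply: zval_inj; rewrite zu -yq.
  have [hp _] := structure_links p; have [hq _] := structure_links q.
  by rewrite el eu hp ?hq ?ep ?eq // ?yp ?yq; lia.
suff lk : links (pmul s w)
    (if simple_root i (z (lower i)) (z (upper i)) then pmul s z else pmul s (pmul z s)) pi.
  split=> //.
  - by move=> p; case: (lk p).
  - by move=> p; case: (lk p).
  - by move=> p /gb gp; rewrite blockE; apply: swap_good => //; apply: ascending_block_at.
  - move=> p q pp qq pq; rewrite !blockE.
    have qp : q <> p by move=> e; apply: pq.
    apply: swap_compatible => //.
    + exact: gb.
    + exact: gb.
    + exact: disjoint_block_at.
    + exact: cb.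
    + exact: cb.
    + exact: ascending_block_at.
    + exact: ascending_block_at.
    + exact: ascending_block_at.
    + exact: ascending_block_at.
    + move=> /= /Nat2Z.inj/esym/val_inj e1 /Nat2Z.inj/esym/val_inj e2; exact: nomerge.
    + move=> /= /Nat2Z.inj/esym/val_inj e1 /Nat2Z.inj/esym/val_inj e2 yq yp; exact: (nomerge q p).
case: ifP => rt.
  have [//|[zlo zup]] := simple_root_images rt.
  (* As z sends i to -(i + 1), these letters belong to one block up to sign; the sign of its sum
     forces the letters -i and i + 1. *)
  have [b [p0 el]] := position_of (lower i).
  have neq_lu : lower i <> upper i by move=> e; move: zl zu; rewrite e; lia.
  case: b el => [el|el]; last first.
    have [h1 h2] := structure_links p0; have h0 := block_sum_neq0 (p := p0) bs.
    exfalso; case: (Z.lt_total 0 (letter w p0 + letter w (pi p0))) => [h|[h|h]]; last 1 first.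
    - move: zlo; rewrite el h2 // => /(can_inj (@pmoppK n)); rewrite -el => e; exact: neq_lu.
    - move: (h); have := h1 h; rewrite -el zlo => e.
      by rewrite /letter -e -el zval_opp zl zu; lia.
    - by apply: h0.
  have el' : w (false, p0) = pmopp (lower i) by rewrite el signed_true // pmoppK.
  have eu : w (false, pi p0) = upper i.
    have [h1 h2] := structure_links p0; have h0 := block_sum_neq0 (p := p0) bs.
    have e : z (w (false, p0)) = upper i by rewrite el' signedP // zlo pmoppK.
    case: (Z.lt_total 0 (letter w p0 + letter w (pi p0))) => [h|[h|h]]; last 1 first.
    - by move: e; rewrite h2 // el' pmoppK.
    - by rewrite -h1.
    - by case: h0.
  have np : pi p0 <> p0.
    by move=> e; move: eu; rewrite e el' => /(congr1 (@zval n)); rewrite zval_opp zl zu; lia.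
  apply: (links_root el (esym eu) rt) => [p n1 n2|p].
    split=> // e; [apply: n2 | apply: n1]; first by rewrite -e piK.
    exact: (can_inj piK).
  rewrite !letter_simple (negPf i0) /letter.
  case=> ->; rewrite ?piK el' eu zval_opp zl zu swapv_opp // swapv_k swapv_k1; split=> h.
  - by lia.
  - by rewrite signedP // zlo simple_gen_opp simple_gen_lower !pmoppK.
  - by lia.
  - by rewrite zup simple_gen_upper.
apply: links_conj => p; rewrite !letter_simple (negPf i0).
have sgn := swapv_lt (- letter w p) (letter w (pi p)) k0.
move: sgn; rewrite swapv_opp // => -[adj|]; last by lia.
(* A sum changes sign only in a block with letters i + 1 and -i; but then z sends i to -(i + 1),
   against [rt]. *)
exfalso; have a1 := ascending_position p (pi p) i0; have a2 := ascending_position (pi p) p i0.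
have root_of q r : letter w q = (- Z.of_nat i)%Z -> letter w r = (Z.of_nat i + 1)%Z ->
    pi q = r -> False.
  move=> yq yr qr; have [h1 _] := structure_links q.
  have eq : lower i = w (true, q).
    by apply: zval_inj; rewrite zl signed_true // zval_opp -/(letter w q); lia.
  have er : upper i = w (false, r) by apply: zval_inj; rewrite zu -yr.
  move/negP: rt; apply; apply/orP; right.
  have e : z (lower i) = pmopp (upper i).
    by rewrite eq signed_true // signedP // h1 qr ?er // yq yr; lia.
  rewrite e eqxx /=; apply/eqP; apply: (@perm_inj _ z).
  by rewrite signedP // e pmoppK -{1}iz permK.
case: adj => -[e1 e2].
- by apply: (root_of p (pi p)) => //; lia.
- by case: a2 => _ [h _]; apply: h => //; lia.
- by case: a1 => _ [h _]; apply: h => //; lia.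
- by apply: (root_of (pi p) p); rewrite ?piK //; lia.
Qed.

Definition merge_partner p0 q0 p := if p == p0 then q0 else if p == q0 then p0 else pi p.

(** A positive letter fixed by z is a one-letter block of positive sum. The ascent of w puts i
    before i + 1, so after the exchange the two letters form a descent, as a two-letter block
    must. *)
Lemma step_merge : i != 0 :> nat -> z (lower i) = lower i -> z (upper i) = upper i ->
  exists pi', block_structure (pmul s w) (pmul s z) pi'.
Proof.
move=> i0 zlo zup; have k0 : (0 < Z.of_nat i)%Z by lia.
have zl : zval (lower i) = Z.of_nat i by rewrite zval_lower (negPf i0).
have zu := zval_upper i.
have rt : simple_root i (z (lower i)) (z (upper i)) by rewrite zlo zup /simple_root !eqxx.
have fixed x : z x = x -> (0 < zval x)%Z -> exists p, [/\ x = w (false, p), pi p = p & letter w p = zval x].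
  move=> zx x0; have [b [p e]] := position_of x.
  have zp : z (w (false, p)) = w (false, p).
    case: b e => [|e]; last by rewrite -e.
    rewrite signed_true // => e; apply: (can_inj (@pmoppK n)); rewrite -signedP // -e //.
  have [h1 h2] := structure_links p; have h0 := block_sum_neq0 (p := p) bs.
  have h : (0 < letter w p + letter w (pi p))%Z.
    case: (Z.lt_total 0 (letter w p + letter w (pi p))) => [//|[h|h]]; first by case: h0.
    move: (h2 h); rewrite zp => /(congr1 (@zval n)); rewrite zval_opp.
    by have := @zval_neq0 n (w (false, p)); lia.
  have ep : pi p = p by move: (h1 h); rewrite zp => /perm_inj[].
  case: b e => e; last by exists p; split=> //; rewrite e.
  by move: h x0; rewrite ep e signed_true // zval_opp /letter; lia.
have [||p0 [el ep0 yp0]] := fixed (lower i) => //; first by rewrite zl.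
have [||q0 [eu eq0 yq0]] := fixed (upper i) => //.
rewrite zl in yp0; rewrite zu in yq0.
have lt_pq : (Z.of_nat p0 < Z.of_nat q0)%Z.
  have [h _] := ascending_position p0 q0 i0; by have [] := h yp0 yq0.
have npq : p0 <> q0 by move=> e; move: lt_pq; rewrite e; lia.
exists (merge_partner p0 q0).
have mp : merge_partner p0 q0 p0 = q0 by rewrite /merge_partner eqxx.
have mq : merge_partner p0 q0 q0 = p0.
  by rewrite /merge_partner eqxx; case: eqP => // e; case: npq.
have mo p : p <> p0 -> p <> q0 -> [/\ merge_partner p0 q0 p = pi p, pi p <> p0 & pi p <> q0].
  move=> n1 n2; rewrite /merge_partner; case: eqP => // _; case: eqP => // _; split=> // e.
    by apply: n1; rewrite -[p]piK e ep0.
  by apply: n2; rewrite -[p]piK e eq0.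
have new_p0 : letter (pmul s w) p0 = (Z.of_nat i + 1)%Z.
  by rewrite letter_simple (negPf i0) yp0 swapv_k.
have new_q0 : letter (pmul s w) q0 = Z.of_nat i.
  by rewrite letter_simple (negPf i0) yq0 swapv_k1.
have new_other p : p <> p0 -> p <> q0 -> letter (pmul s w) p = letter w p.
  by move=> n1 n2; rewrite /letter {1}/pmul permM (simple_gen_other el eu).
have lk : links (pmul s w) (pmul s z) (merge_partner p0 q0).
  apply: (links_root el eu rt) => // p; case=> ->; rewrite ?mp ?mq new_p0 new_q0 -?el -?eu.
    by rewrite /s simple_gen_upper; split=> //; lia.
  by rewrite /s simple_gen_lower; split=> //; lia.
have block_p0 : block_at (pmul s w) (merge_partner p0 q0) p0 =
    Block (Z.of_nat p0) (Z.of_nat q0) (Z.of_nat i + 1) (Z.of_nat i).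
  by rewrite /block_at mp new_p0 new_q0.
have block_other p : p <> p0 -> p <> q0 ->
    block_at (pmul s w) (merge_partner p0 q0) p = block_at w pi p.
  by move=> n1 n2; have [e n3 n4] := mo p n1 n2; rewrite /block_at e !new_other.
have bp0 : block_at w pi p0 = Block (Z.of_nat p0) (Z.of_nat p0) (Z.of_nat i) (Z.of_nat i).
  by rewrite /block_at ep0 yp0.
have bq0 : block_at w pi q0 = Block (Z.of_nat q0) (Z.of_nat q0) (Z.of_nat i + 1) (Z.of_nat i + 1).
  by rewrite /block_at eq0 yq0.
have rep p : p <= merge_partner p0 q0 p -> p = p0 \/ [/\ p <> p0, p <> q0 & p <= pi p].
  move=> h; case: (eqVneq p p0) => [|/eqP n1]; [by left | right].
  have n2 : p <> q0 by move=> e; move: h; rewrite e mq; lia.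
  by split=> //; have [e _ _] := mo p n1 n2; rewrite -e.
case: (bs) => _ _ _ gb cb.
have merge p : p <> p0 -> p <> q0 -> p <= pi p ->
    let AB := Block (Z.of_nat p0) (Z.of_nat q0) (Z.of_nat i + 1) (Z.of_nat i) in
    compatible AB (block_at w pi p) /\ compatible (block_at w pi p) AB.
  move=> n1 n2 pp.
  have [n1' n2'] : p0 <> p /\ q0 <> p by split=> e; [apply: n1 | apply: n2].
  have [pp0 qq0] : p0 <= pi p0 /\ q0 <= pi q0 by rewrite ep0 eq0.
  apply: merge_compatible => //; rewrite -?bp0 -?bq0.
  - exact: gb.
  - exact: disjoint_block_at.
  - exact: disjoint_block_at.
  - exact: cb.
  - exact: cb.
  - exact: cb.
  - exact: cb.
split.
- move=> p; case: (eqVneq p p0) => [->|/eqP n1]; first by rewrite mp mq.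
  case: (eqVneq p q0) => [->|/eqP n2]; first by rewrite mq mp.
  have [-> n3 n4] := mo p n1 n2; have [-> _ _] := mo _ n3 n4; exact: piK.
- by move=> p; case: (lk p).
- by move=> p; case: (lk p).
- move=> p /rep[->|[n1 n2 pp]]; last by rewrite block_other //; apply: gb.
  by rewrite block_p0 /good_block; lia.
- move=> p q /rep[->|[n1 n2 pp]] /rep[->|[n3 n4 qq]] // pq.
  + by rewrite block_p0 block_other //; have [] := merge q n3 n4 qq.
  + by rewrite block_p0 block_other //; have [] := merge p n1 n2 pp.
  + by rewrite !block_other //; apply: cb.
Qed.

Lemma step_flip : i = 0 :> nat ->
  block_structure (pmul s w)
    (if simple_root i (z (lower i)) (z (upper i)) then pmul s z else pmul s (pmul z s)) pi.
Proof.
move=> i0; have zl : zval (lower i) = (-1)%Z by rewrite zval_lower i0.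
have zu : zval (upper i) = 1%Z by rewrite zval_upper i0.
have el : lower i = pmopp (upper i) by apply: zval_inj; rewrite zval_opp zl zu.
have pos_zu : (0 < zval (z (upper i)))%Z.
  by move: lt_z; rewrite el signedP // => /pmltP; rewrite zval_opp; lia.
have [p0 eu] : exists p0, upper i = w (false, p0).
  have [b [p0 e]] := position_of (upper i); exists p0; case: b e => // e.
  move: asc_w; rewrite /ascent el e -signedP // !permK => /pmltP.
  by rewrite zval_opp /zval /=; lia.
have el' : lower i = w (true, p0) by rewrite el eu signed_true.
have yp0 : letter w p0 = 1%Z by rewrite /letter -eu.
have other p : p <> p0 -> letter w p <> 1%Z /\ letter w p <> (-1)%Z.
  move=> n1; split=> e; first by apply: n1; apply: (@letter_inj _ w); rewrite e yp0.
  by apply: (@letter_opp _ w p p0 sw); rewrite e yp0.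
have new_p0 : letter (pmul s w) p0 = (-1)%Z by rewrite letter_simple i0 yp0.
have new_other p : p <> p0 -> letter (pmul s w) p = letter w p.
  move=> n1; rewrite letter_simple i0 /=; have [n2 n3] := other p n1.
  by case: (flipvP (letter w p)) => [[]|[[]|[]]].
case: (bs) => _ _ _ gb cb.
have [p1 [p1p1 p1E rep_p1]] : exists p1, [/\ p1 <= pi p1, p1 = p0 \/ p1 = pi p0
    & forall p, p <= pi p -> p = p0 -> p = p1].
  case: (leqP p0 (pi p0)) => h; first by exists p0; split; auto.
  exists (pi p0); split; [by rewrite piK; apply: ltnW | by right |].
  by move=> p + e; rewrite e leqNgt h.
have pos_sum : (0 < letter w p0 + letter w (pi p0))%Z.
  have [h1 h2] := structure_links p0; have h0 := block_sum_neq0 (p := p0) bs.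
  case: (Z.lt_total 0 (letter w p0 + letter w (pi p0))) => [//|[h|h]]; first by case: h0.
  by move: pos_zu; rewrite eu h2 // zval_opp -eu zu; lia.
(* If 1 came first in a two-letter block, the other letter would be negative and the sum not
   positive. *)
have last_p1 : pi p1 = p0.
  case: p1E => e; last by rewrite e piK.
  have := gb p1 p1p1; rewrite /good_block /block_at e yp0 => -[_ [[h _]|[h h']]].
    by apply: val_inj => /=; lia.
  by have := @zval_neq0 n (w (false, pi p0)); rewrite -/(letter _ _); move: pos_sum; rewrite yp0; lia.
have block_p1 : block_at w pi p1 = Block (Z.of_nat p1) (Z.of_nat p0) (letter w p1) 1.
  by rewrite /block_at last_p1 yp0.
have new_p1 : block_at (pmul s w) pi p1 = Block (Z.of_nat p1) (Z.of_nat p0)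
    (if (Z.of_nat p1 =? Z.of_nat p0)%Z then -1 else letter w p1)%Z (-1).
  rewrite /block_at last_p1 new_p0; congr Block.
  case: Z.eqb_spec => [/Nat2Z.inj/val_inj ->//|h]; apply: new_other => e; apply: h.
  by rewrite e.
have block_other p : p <= pi p -> p <> p1 -> block_at (pmul s w) pi p = block_at w pi p.
  move=> pp n1.
  have n2 : p <> p0.
    by move=> e; apply: n1; apply: rep_p1.
  have n3 : pi p <> p0.
    move=> e; apply: n1; have : pi p = pi p1 by rewrite last_p1.
    exact: (can_inj piK).
  by rewrite /block_at !new_other.
have flip p : p <= pi p -> p <> p1 ->
    [/\ good_block (block_at (pmul s w) pi p1),
       compatible (block_at (pmul s w) pi p1) (block_at w pi p)
     & compatible (block_at w pi p) (block_at (pmul s w) pi p1)].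
  move=> pp n1; have n1' : p1 <> p by move=> e; apply: n1.
  rewrite new_p1; apply: flip_compatible; rewrite -?block_p1.
  - exact: gb.
  - exact: gb.
  - exact: disjoint_block_at.
  - exact: zval_neq0.
  - exact: zval_neq0.
  - exact: cb.
  - exact: cb.
have good_p1 : good_block (block_at (pmul s w) pi p1).
  have := gb p1 p1p1; rewrite new_p1 block_p1 /good_block.
  case: Z.eqb_spec => h; lia.
suff lk : links (pmul s w)
    (if simple_root i (z (lower i)) (z (upper i)) then pmul s z else pmul s (pmul z s)) pi.
  split=> //.
  - by move=> p; case: (lk p).
  - by move=> p; case: (lk p).
  - move=> p pp; case: (eqVneq p p1) => [->//|/eqP n1].
    by rewrite block_other //; apply: gb.
  - move=> p q pp qq pq; case: (eqVneq p p1) => [ep|/eqP n1].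
      have n2 : q <> p1 by move=> e; apply: pq; rewrite ep e.
      by rewrite ep (block_other q) //; have [] := flip q qq n2.
    case: (eqVneq q p1) => [eq|/eqP n2].
      by rewrite eq (block_other p) //; have [] := flip p pp n1.
    by rewrite !block_other //; apply: cb.
have zup : z (upper i) = w (false, pi p0) by have [h _] := structure_links p0; rewrite eu h.
case: ifP => rt.
  have fix_u : z (upper i) = upper i.
    by case: (simple_root_images rt) => -[_ ->] //; rewrite el pmoppK.
  have ep0 : pi p0 = p0 by move: fix_u; rewrite zup eu => /perm_inj[].
  apply: (links_root el' eu rt) => [p n1 _|p].
    by split=> // e; apply: n1; rewrite -[p]piK e ep0.
  have -> : p = p0 \/ p = p0 <-> p = p0 by split=> [[]|] //; left.
  move=> ->; rewrite ep0 new_p0; split=> [|_]; first by lia.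
  by rewrite -eu fix_u /s simple_gen_upper el pmoppK.
(* Here z does not fix 1, so the block of 1 has a second letter greater than 1 and its sum stays
   positive. *)
apply: links_conj => p.
have np0 : pi p0 <> p0.
  move=> e; move/negP: rt; apply; have fix_u : z (upper i) = upper i by rewrite zup e eu.
  by rewrite /simple_root el signedP // fix_u !eqxx.
have np1 : p1 <> p0 by move=> e; apply: np0; rewrite -{1}e last_p1.
have ep1 : p1 = pi p0 by case: p1E.
have big : (1 < letter w (pi p0))%Z.
  have := gb p1 p1p1; rewrite block_p1 /good_block ep1 => -[_ [[h _]|[_ [h _]]]] //.
  by case: np0; apply: val_inj => /=; lia.
case: (eqVneq p p0) => [->|/eqP n1]; first by rewrite new_p0 new_other // yp0; lia.
case: (eqVneq (pi p) p0) => [e|/eqP n2]; last by rewrite !new_other.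
have -> : p = pi p0 by rewrite -e piK.
by rewrite piK new_p0 new_other // yp0; lia.
Qed.

End Step.

Lemma path_block_structure w z : involution_path w z -> exists pi, block_structure w z pi.
Proof.
elim=> {w z} [|i w z path_wz [pi bs] asc_w asc_z].
  by exists id; apply: block_structure_one.
have [sw sz iz] := path_signed path_wz.
case: (eqVneq (i : nat) 0) => i0; first by exists pi; apply: step_flip.
case: (eqVneq (z (lower i)) (lower i)) => [zl|/eqP zl]; last first.
  by exists pi; apply: step_swap => // -[].
case: (eqVneq (z (upper i)) (upper i)) => [zu|/eqP zu]; last first.
  by exists pi; apply: step_swap => // -[].
have [pi' bs'] := step_merge sw sz iz asc_w asc_z bs i0 zl zu.
by exists pi'; rewrite {1}zl {1}zu /simple_root !eqxx.
Qed.

End Induction.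

Theorem theorem5p7 (n : nat) (hn : (0 < n)%N)
    (dem : {perm pm n} -> {perm pm n} -> {perm pm n})
    (hdem : is_demazure_product dem)
    (z : {perm pm n}) (hz : z \in involutions n)
    (w : {perm pm n}) (hw : w \in inv_atoms dem z)
    (M : {set {set pm n}}) (hM : is_shape w M) :
  M \in NCSP z.
Proof.
have path_wz := inv_atoms_path hdem hw; have [sw sz _] := path_signed path_wz.
have [pi bs] := path_block_structure path_wz.
case: hM => D [r [nd ->]].
by rewrite (shape_of_partner_shape sw sz bs nd); apply: partner_shape_NCSP.
Qed.
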